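(* Let $f$ be a proper log-concave function on $\mathbb{R}^d$. Then there exist a positive definite matrix $A\in\mathbb{R}^{d\times d}$, a number $\alpha>0$ and a vector $a\in\mathbb{R}^d$ such that: (1) the function $\alpha\chi_{A\mathbf{B}^d+a}$ is pointwise less than or equal to $f$; (2) as $s\to0^+$, the John $s$-functions ${}^{(s)}J_f$ of $f$ converge uniformly to $\alpha\chi_{A\mathbf{B}^d+a}$ on the complement of any open neighborhood of the boundary in $\mathbb{R}^d$ of $A\mathbf{B}^d+a$; (3) the function $\alpha\chi_{A\mathbf{B}^d+a}$ is the unique flat ellipsoid function of maximal integral among all flat ellipsoid functions that are pointwise less than or equal to $f$.
   Context: A function $f:\mathbb{R}^d\to[0,\infty)$ is log-concave if $f=e^{-\psi}$ for some convex $\psi:\mathbb{R}^d\to\mathbb{R}\cup\{\infty\}$; it is proper log-concave if moreover it is upper semi-continuous and has finite positive integral. $\mathbf{B}^n$ is the Euclidean unit ball of $\mathbb{R}^n$ and $\chi$ denotes characteristic functions. A flat ellipsoid function is a function $\beta\chi_E$ with $\beta>0$ and $E\subset\mathbb{R}^d$ an ellipsoid (a set $A\mathbf{B}^d+a$ with $A$ positive definite). For a positive definite $A\in\mathbb{R}^{d\times d}$, $\alpha>0$, $a\in\mathbb{R}^d$, the $d$-symmetric ellipsoid $\overline{E}=(A\oplus\alpha)\mathbf{B}^{d+1}+a\subset\mathbb{R}^{d+1}$ (with $A\oplus\alpha$ block-diagonal and $\mathbb{R}^d$ identified with the span of the first $d$ basis vectors) has height function $\hslash_{\overline{E}}(x)=\alpha\sqrt{1-|A^{-1}(x-a)|^2}$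 for $x\in A\mathbf{B}^d+a$ and $0$ otherwise. For $s>0$ the $s$-lifting of $f$ is ${}^{(s)}\overline{f}=\{(x,\xi)\in\mathbb{R}^{d+1}:|\xi|\le f(x)^{1/s}\}$, and the $s$-volume of $\overline{E}$ is ${}^{(s)}\mu(\overline{E})=\int_{\mathbb{R}^d}\hslash_{\overline{E}}^s$. There is a unique $d$-symmetric ellipsoid of maximal $s$-volume contained in ${}^{(s)}\overline{f}$, called the John $s$-ellipsoid $\overline{E}(f,s)$ of $f$; the John $s$-function of $f$ is ${}^{(s)}J_f=\hslash_{\overline{E}(f,s)}^s$. *)

(* Defs.v *)
From HB Require Import structures.
From mathcomp Require Import all_boot all_order all_algebra.
From mathcomp Require Import all_classical all_reals all_analysis.

Set Implicit Arguments.
Unset Strict Implicit.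
Unset Printing Implicit Defensive.

Import Order.TTheory GRing.Theory Num.Theory.
Import numFieldNormedType.Exports.

Local Open Scope classical_set_scope.
Local Open Scope ring_scope.

(* MathComp-Analysis has no measurable structure on 'cV[R]_n, so Lebesgue     *)
(* measure on R^n is the n-fold product of the one-dimensional Lebesgue       *)
(* measure, on n.-tuple R with the product sigma-algebra.                     *)

Section power_measure.
Context {d : measure_display} {T : measurableType d} {R : realType}.
Variable m : {sigma_finite_measure set T -> \bar R}.

Definition tcons n (p : T * n.-tuple T) : n.+1.-tuple T :=
  [tuple of p.1 :: p.2].

Lemma measurable_tcons n : measurable_fun setT (@tcons n).
Proof. exact: measurable_cons. Qed.

Section step.
Variables (n : nat) (mu : {sigma_finite_measure set (n.-tuple T) -> \bar R}).

Definition power_step : set (n.+1.-tuple T) -> \bar R :=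
  pushforward (m \x mu)%E (@tcons n).

Let power_step0 : power_step set0 = 0%E.
Proof. have mc := @measurable_tcons n; exact: measure0. Qed.

Let power_step_ge0 A : (0 <= power_step A)%E.
Proof. have mc := @measurable_tcons n; exact: measure_ge0. Qed.

Let power_step_sigma_additive : semi_sigma_additive power_step.
Proof.
have mc := @measurable_tcons n; exact: measure_semi_sigma_additive.
Qed.

HB.instance Definition _ := isMeasure.Build _ _ _ power_step
  power_step0 power_step_ge0 power_step_sigma_additive.

Lemma power_step_sigma_finite : sigma_finite setT power_step.
Proof.
have /sigma_finiteP[F [TF ndF Foo]] := sigma_finiteT m.
have /sigma_finiteP[G [TG ndG Goo]] := sigma_finiteT mu.
pose g (t : n.+1.-tuple T) := (thead t, [tuple of behead t]).
have tK p : g (tcons p) = p.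
  by case: p => x y; rewrite /g /tcons theadE; congr pair; exact/val_inj.
have mg : measurable_fun setT g.
  apply: measurable_fun_pair; first exact: measurable_tnth.
  exact: measurable_behead.
exists (fun k => g @^-1` (F k `*` G k)) => [|k].
  apply/esym/seteqP; split => // t _.
  have : (\bigcup_i F i) (g t).1 by rewrite -TF.
  have : (\bigcup_i G i) (g t).2 by rewrite -TG.
  move=> [j _ Gj] [i _ Fi]; exists (maxn i j) => //; split.
    by move: Fi; exact/subsetPset/ndF/leq_maxl.
  by move: Gj; exact/subsetPset/ndG/leq_maxr.
have [mF mFoo] := Foo k; have [mG mGoo] := Goo k; split.
  by rewrite -[X in measurable X]setTI; apply: mg => //; exact: measurableX.
rewrite /power_step /pushforward.
have -> : @tcons n @^-1` (g @^-1` (F k `*` G k)) = F k `*` G k.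
  by rewrite -comp_preimage (_ : g \o _ = id)//; exact/funext.
by rewrite product_measure1E// lte_mul_pinfty// ge0_fin_numE.
Qed.

HB.instance Definition _ :=
  Measure_isSigmaFinite.Build _ _ _ power_step power_step_sigma_finite.

End step.

Fixpoint power_measure n : {sigma_finite_measure set (n.-tuple T) -> \bar R} :=
  match n with
  | 0 => dirac ([tuple] : 0.-tuple T)
  | k.+1 => power_step (power_measure k)
  end.

End power_measure.

Section definitions.
Variable R : realType.

Definition integral_cV n (g : 'cV[R]_n -> R) : \bar R :=
  (\int[power_measure (@lebesgue_measure R) n]_t (g (\col_i tnth t i))%:E)%E.

(* The library norm on matrices is the sup norm. *)
Definition enorm n (x : 'cV[R]_n) : R := Num.sqrt (\sum_i x i 0 ^+ 2).

Definition unit_ball n : set 'cV[R]_n := [set x | enorm x <= 1].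

Definition posdef n (A : 'M[R]_n) : Prop :=
  A^T = A /\ forall x : 'cV[R]_n, x != 0 -> 0 < (x^T *m A *m x) 0 0.

Definition ellipsoid n (A : 'M[R]_n) (a : 'cV[R]_n) : set 'cV[R]_n :=
  [set A *m u + a | u in @unit_ball n].

Definition boundary (X : topologicalType) (E : set X) : set X :=
  closure E `\` interior E.

Section functions.
Variable d : nat.
Implicit Types (f g : 'cV[R]_d -> R) (psi : 'cV[R]_d -> \bar R).
Implicit Types (A : 'M[R]_d) (alpha beta s : R) (a : 'cV[R]_d).

Definition ext_convex psi : Prop :=
  (forall x, psi x != -oo%E) /\
  forall (x y : 'cV[R]_d) (t : R), 0 <= t <= 1 ->
    (psi (t *: x + (1 - t) *: y)%R
      <= t%:E * psi x + (1 - t)%R%:E * psi y)%E.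

Definition log_concave f : Prop :=
  exists psi, ext_convex psi /\ forall x, (f x)%:E = expeR (- psi x)%E.

Definition upper_semicontinuous f : Prop :=
  forall x b, f x < b -> \forall y \near x, f y < b.

Definition proper_log_concave f : Prop :=
  [/\ log_concave f, upper_semicontinuous f &
      (0 < integral_cV f < +oo)%E].

Definition flat_fun beta A a : 'cV[R]_d -> R :=
  fun x => beta * \1_(ellipsoid A a) x.

Definition flat_ellipsoid_function g : Prop :=
  exists beta A a, [/\ 0 < beta, posdef A & g = flat_fun beta A a].

Definition max_flat_ellipsoid_function f g : Prop :=
  [/\ flat_ellipsoid_function g,
      forall x, g x <= f x &
      forall h, flat_ellipsoid_function h -> (forall x, h x <= f x) ->
        (integral_cV h <= integral_cV g)%E].

(* A point (x, xi) of R^(d+1) is the column vector whose upper block is x and *)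
(* whose last coordinate is xi.                                               *)
Definition s_lifting f s : set 'cV[R]_(d + 1) :=
  [set z | `|dsubmx z 0 0| <= f (usubmx z) `^ s^-1].

Definition dsym_ellipsoid A alpha a : set 'cV[R]_(d + 1) :=
  ellipsoid (block_mx A 0 0 alpha%:M) (col_mx a 0).

Definition height A alpha a : 'cV[R]_d -> R :=
  fun x => if x \in ellipsoid A a
           then alpha * Num.sqrt (1 - enorm (invmx A *m (x - a)) ^+ 2)
           else 0.

Definition s_volume s A alpha a : \bar R :=
  integral_cV (fun x => height A alpha a x `^ s).

Definition is_John_s_ellipsoid f s A alpha a : Prop :=
  [/\ posdef A, 0 < alpha, dsym_ellipsoid A alpha a `<=` s_lifting f s &
      forall (B : 'M[R]_d) (beta : R) (b : 'cV[R]_d),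
        posdef B -> 0 < beta -> dsym_ellipsoid B beta b `<=` s_lifting f s ->
        (s_volume s B beta b <= s_volume s A alpha a)%E].

(* The John s-ellipsoid, through its parameters (A, alpha, a); these are      *)
(* determined by the ellipsoid as A is positive definite and alpha > 0.       *)
Definition John_s_ellipsoid f s : 'M[R]_d * R * 'cV[R]_d :=
  get [set E | is_John_s_ellipsoid f s E.1.1 E.1.2 E.2].

Definition John_s_function f s : 'cV[R]_d -> R :=
  let E := John_s_ellipsoid f s in fun x => height E.1.1 E.1.2 E.2 x `^ s.

End functions.
End definitions.

(* Main.v *)
(* Put [cap s u := sqrt (1 - |u|^2) `^ s] on the unit ball and [0] elsewhere.
   With [b := alpha `^ s], the ellipsoid of parameters [(A, alpha, a)] lies in
   the s-lifting of [f] iff [b * cap s u <= f (A u + a)] for all [|u| <= 1], and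
   its s-volume is [b * \det A] times a constant depending on [s] only.  At
   [s = 0] one gets the flat ellipsoid functions below [f], so that both
   problems maximize [b * \det A] over a set of feasible [(b, A, a)] indexed by
   [s].  As [f] is log-concave with finite positive mass, the feasible
   parameters with [b * \det A] bounded below stay, uniformly in [s] in [0, 1],
   in a compact set on which [b] is bounded below, and by upper semicontinuity
   limits of feasible parameters are feasible.  This gives maximizers for each
   [s], and shows that every cluster point as [s --> 0^+] of the John parameters
   is a flat maximizer.  The latter is unique, by log-concavity of [f] and of
   the determinant, so the John parameters converge to it. *)
Require Import Defs.
From mathcomp Require Import all_boot all_order all_algebra.
From mathcomp Require Import all_classical all_reals all_analysis.
From mathcomp Require Import measurable_realfun ring lra.

Set Implicit Arguments.
Unset Strict Implicit.
Unset Printing Implicit Defensive.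

Import Order.TTheory GRing.Theory Num.Theory.
Import numFieldNormedType.Exports.
Local Open Scope classical_set_scope.
Local Open Scope ring_scope.

(** * Determinants of positive definite matrices *)

Section posdef.
Variable R : realType.

(** Every a priori bound rests on one device: exhibit a flat ellipsoid below [f] and compare its
    [b * \det A] with [mass f]. Positivity of the integral enters because it cannot be carried by a
    hyperplane, which yields a ball on which [f >= m > 0]. The delicate bound is the one on [b] from
    below, since a large matrix could compensate a small height: the geometric mean with a fixed
    value of [f] turns [b] into a multiple of [sqrt b], which the mass bound and [v <= b * \det A]
    together keep away from 0. The problems for different [s] are linked by [cap s <= cap 0]: the
    flat maximizer competes at every [s] in (0, 1], so the John values of [b * \det A] never drop
    below the flat maximum, and neither do their limits. Neighborhoods of the boundary are removed
    because on the unit sphere [cap s] is 0 for [s > 0] but 1 for [s = 0]. *)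

Definition qf n (A : 'M[R]_n) (x : 'cV[R]_n) : R := (x^T *m A *m x) 0 0.
Definition dotmx n (v x : 'cV[R]_n) : R := (v^T *m x) 0 0.

Definition schur n (A : 'M[R]_(1 + n)) : 'M[R]_n :=
  drsubmx A - (A 0 0)^-1 *: (dlsubmx A *m (dlsubmx A)^T).

Lemma posdef_block n (A : 'M[R]_(1 + n)) : A^T = A ->
  A = block_mx (A 0 0)%:M (dlsubmx A)^T (dlsubmx A) (drsubmx A).
Proof.
move=> At; rewrite -[LHS]submxK; congr block_mx; last by rewrite trmx_dlsub At.
by rewrite [LHS]mx11_scalar /ulsubmx !mxE !lshift0.
Qed.

Lemma schurK n (A : 'M[R]_(1 + n)) :
  drsubmx A = schur A + (A 0 0)^-1 *: (dlsubmx A *m (dlsubmx A)^T).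
Proof. by rewrite /schur subrK. Qed.

(** Completing the square in the first coordinate [t]. *)
Lemma qf_block n (A : 'M[R]_(1 + n)) (t : R) (x : 'cV[R]_n) :
  A^T = A -> A 0 0 != 0 ->
  qf A (col_mx t%:M x) =
    A 0 0 * (t + (A 0 0)^-1 * dotmx (dlsubmx A) x) ^+ 2 + qf (schur A) x.
Proof.
move=> At p0; rewrite {1}/qf {1}(posdef_block At) schurK.
set p := A 0 0; set v := dlsubmx A; set S := schur A.
rewrite tr_col_mx mul_row_block mul_row_col !mulmxDl.
rewrite tr_scalar_mx.
have xv : x^T *m v = v^T *m x.
  by rewrite -[LHS]trmxK trmx_mul trmxK [LHS]mx11_scalar [RHS]mx11_scalar mxE.
rewrite mulmxDr mulmxDl -scalemxAr -scalemxAl mulmxA -[X in p^-1 *: X]mulmxA xv.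
rewrite -[t%:M *m v^T *m x]mulmxA [v^T *m x]mx11_scalar -!scalar_mxM.
rewrite -/(dotmx v x) mxE [in X in _ + X]mxE.
rewrite !mxE /= !mulr1n -/(qf S x).
have alg (p' d q : R) : p' != 0 -> t * p' * t + d * t +
    (t * d + (q + p'^-1 * (d * d))) = p' * (t + p'^-1 * d) ^+ 2 + q.
  by move=> ?; field.
by rewrite -alg ?[qf S x]mxE.
Qed.

Lemma qf_delta n (A : 'M[R]_n) i : qf A (delta_mx i 0) = A i i.
Proof. by rewrite /qf trmx_delta -rowE -colE !mxE. Qed.

Lemma delta_neq0 n (i : 'I_n) : delta_mx i 0 != 0 :> 'cV[R]_n.
Proof.
apply/eqP => /matrixP/(_ i 0); rewrite !mxE !eqxx /= => /eqP.
by rewrite oner_eq0.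
Qed.

Lemma posdef_diag n (A : 'M[R]_n) i : posdef A -> 0 < A i i.
Proof. by move=> [_ /(_ _ (delta_neq0 i))]; rewrite -/(qf _ _) qf_delta. Qed.

Lemma schur_sym n (A : 'M[R]_(1 + n)) : A^T = A -> (schur A)^T = schur A.
Proof.
move=> At; rewrite /schur linearB /= linearZ /= trmx_mul trmxK.
by rewrite trmx_drsub At.
Qed.

(** The first coordinate is the one that annihilates the square in [qf_block]. *)
Lemma qf_schur n (A : 'M[R]_(1 + n)) x : A^T = A -> A 0 0 != 0 ->
  qf (schur A) x = qf A (col_mx (- ((A 0 0)^-1 * dotmx (dlsubmx A) x))%:M x).
Proof. by move=> At p0; rewrite qf_block// addNr expr0n mulr0 add0r. Qed.

Lemma posdef_schur n (A : 'M[R]_(1 + n)) : posdef A -> posdef (schur A).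
Proof.
move=> pA; have /gt_eqF/negbT p0 := posdef_diag 0 pA; case: pA => At Apos.
split; first exact: schur_sym.
move=> x x0; rewrite -/(qf _ _) qf_schur//; apply: Apos.
by rewrite col_mx_eq0 negb_and x0 orbT.
Qed.

(** One step of block elimination: a unit lower triangular factor leaves an upper triangular block
    matrix. *)
Lemma det_schur n (A : 'M[R]_(1 + n)) : A^T = A -> A 0 0 != 0 ->
  \det A = A 0 0 * \det (schur A).
Proof.
move=> At p0; rewrite {1}(posdef_block At).
set p := A 0 0 in p0 *; set v := dlsubmx A; set S := schur A.
have -> : block_mx p%:M v^T v (drsubmx A) =
    block_mx 1%:M 0 (p^-1 *: v) 1%:M *m block_mx p%:M v^T 0 S.
  rewrite mulmx_block !mul1mx !mul0mx !addr0 mul_mx_scalar scalerA mulfV//.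
  by rewrite scale1r schurK -scalemxAl addrC.
by rewrite det_mulmx det_lblock det_ublock !det1 !mul1r det_scalar expr1.
Qed.

Lemma posdef_det_gt0 n (A : 'M[R]_n) : posdef A -> 0 < \det A.
Proof.
elim: n A => [|n IH] A pA; first by rewrite det_mx00.
have p0 := posdef_diag 0 pA.
rewrite (@det_schur n) ?gt_eqF//; last by case: pA.
by rewrite mulr_gt0// IH//; exact: posdef_schur.
Qed.

Lemma dotmx_inj n (v w : 'cV[R]_n) :
  (forall x, dotmx v x = dotmx w x) -> v = w.
Proof.
move=> vw; apply/colP => i; have := vw (delta_mx i 0).
by rewrite /dotmx -!colE !mxE.
Qed.

(* The Schur complement is the minimum of the form over the first coordinate,
   which transfers the hypothesis from the forms to their Schur complements. *)
Lemma det_midpoint n (A B M : 'M[R]_n) : posdef A -> posdef B -> posdef M ->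
  (forall x, qf A x + qf B x <= 2 * qf M x) ->
  \det A * \det B <= \det M ^+ 2 /\
  (\det A * \det B = \det M ^+ 2 -> A = M /\ B = M).
Proof.
elim: n A B M => [|n IH] A B M pA pB pM ABM.
  by rewrite !det_mx00 expr1n mulr1; split => // _; split; apply/matrixP => -[].
have a0 := posdef_diag 0 pA; have b0 := posdef_diag 0 pB.
have m0 := posdef_diag 0 pM.
have sA : A^T = A by case: pA.
have sB : B^T = B by case: pB.
have sM : M^T = M by case: pM.
have abm : A 0 0 + B 0 0 <= 2 * M 0 0.
  by have := ABM (delta_mx 0 0); rewrite !qf_delta.
(* With the first coordinate minimizing the form of [M], the right-hand side is exactly the Schur
   form of [M], while the left-hand side carries two nonnegative squares. Dropping them feeds the
   induction; keeping them settles the equality case. *)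
have key x : let t := - ((M 0 0)^-1 * dotmx (@dlsubmx _ 1 n 1 n M) x) in
    (A 0 0 * (t + (A 0 0)^-1 * dotmx (@dlsubmx _ 1 n 1 n A) x) ^+ 2 +
     qf (@schur n A) x) +
    (B 0 0 * (t + (B 0 0)^-1 * dotmx (@dlsubmx _ 1 n 1 n B) x) ^+ 2 +
     qf (@schur n B) x) <= 2 * qf (@schur n M) x.
  move=> t; rewrite -!(@qf_block n) ?gt_eqF// (@qf_schur n M) ?gt_eqF//.
have [] := IH _ _ _ (posdef_schur pA) (posdef_schur pB) (posdef_schur pM).
  move=> x; apply: le_trans (key x) => /=.
  by apply: lerD; rewrite lerDr mulr_ge0 ?sqr_ge0// ltW.
move: (posdef_det_gt0 (posdef_schur pA)) (posdef_det_gt0 (posdef_schur pB)).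
move: (posdef_det_gt0 (posdef_schur pM)).
rewrite (@det_schur n A) ?gt_eqF// (@det_schur n B) ?gt_eqF//.
rewrite (@det_schur n M) ?gt_eqF//.
set al := \det (schur A); set be := \det (schur B); set mu := \det (schur M).
set a := A 0 0 in a0 abm key *; set b := B 0 0 in b0 abm key *.
set m := M 0 0 in m0 abm key *.
move=> mu0 al0 be0 albe eq_schur.
have ab_m2 : a * b <= m ^+ 2.
  have /= : (a + b) ^+ 2 <= (2 * m) ^+ 2 by rewrite ler_sqr ?nnegrE; lra.
  by have := sqr_ge0 (a - b); nra.
have -> : a * al * (b * be) = (a * b) * (al * be) by ring.
rewrite exprMn; split; first by rewrite ler_pM// mulr_ge0// ltW.
move=> e.
have m2 : 0 < m ^+ 2 by rewrite exprn_gt0.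
have mu2 : 0 < mu ^+ 2 by rewrite exprn_gt0.
have albeE : al * be = mu ^+ 2.
  apply/eqP; rewrite eq_le albe /= -(ler_pM2l m2) -e ler_wpM2r//.
  by rewrite mulr_ge0// ltW.
have abE : a * b = m ^+ 2.
  by move: e; rewrite albeE => /mulIf; apply; rewrite gt_eqF.
have [SA SB] := eq_schur albeE.
have ab : a = b.
  apply/eqP; rewrite -subr_eq0 -sqrf_eq0 eq_le sqr_ge0 andbT.
  have /= : (a + b) ^+ 2 <= (2 * m) ^+ 2 by rewrite ler_sqr ?nnegrE; lra.
  by nra.
have am : a = m.
  by move: abE; rewrite -ab => /eqP; rewrite -expr2 eqrXn2 ?ltW// => /eqP.
have bm : b = m by rewrite -ab.
(* The Schur forms now cancel in [key], so both squares vanish and the off-diagonal blocks agree. *)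
have vE x : dotmx (@dlsubmx _ 1 n 1 n A) x = dotmx (@dlsubmx _ 1 n 1 n M) x /\
    dotmx (@dlsubmx _ 1 n 1 n B) x = dotmx (@dlsubmx _ 1 n 1 n M) x.
  have := key x => /=; rewrite SA SB am bm.
  set u := dotmx _ x; set v := dotmx _ x; set w := dotmx _ x.
  have -> : - (m^-1 * u) + m^-1 * v = m^-1 * (v - u) by ring.
  have -> : - (m^-1 * u) + m^-1 * w = m^-1 * (w - u) by ring.
  have sq y : 0 <= m * (m^-1 * y) ^+ 2 by rewrite mulr_ge0 ?sqr_ge0// ltW.
  have sq0 y : m * (m^-1 * y) ^+ 2 = 0 -> y = 0.
    move/eqP; rewrite mulf_eq0 gt_eqF//= sqrf_eq0 mulf_eq0 invr_eq0 gt_eqF//=.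
    by move/eqP.
  move=> h; have := sq (v - u); have := sq (w - u) => h1 h2.
  by split; apply/subr0_eq/sq0; lra.
have vA : @dlsubmx _ 1 n 1 n A = @dlsubmx _ 1 n 1 n M.
  by apply: dotmx_inj => x; have [] := vE x.
have vB : @dlsubmx _ 1 n 1 n B = @dlsubmx _ 1 n 1 n M.
  by apply: dotmx_inj => x; have [] := vE x.
split.
  rewrite (@posdef_block n A)// [RHS](@posdef_block n M)// !schurK.
  by rewrite vA SA -/a -/m am.
rewrite (@posdef_block n B)// [RHS](@posdef_block n M)// !schurK.
by rewrite vB SB -/b -/m bm.
Qed.

End posdef.

(** * Lebesgue measure on column vectors *)

Section cov1.
Variable R : realType.
Local Open Scope ereal_scope.
Notation mu := (@lebesgue_measure R).
Notation T := (measurableTypeR R).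

(** By uniqueness of Lebesgue measure: [p] times the image of [mu] under [phi] agrees with [mu] on
    the intervals []a, b]]. *)
Lemma ge0_integral_affine (f : T -> \bar R) (p c : R) : (0 < p)%R ->
  measurable_fun [set: T] f -> (forall x, 0 <= f x) ->
  \int[mu]_x f (p * x + c)%R = p^-1%:E * \int[mu]_x f x.
Proof.
move=> p0 mf f0.
pose phi (x : T) : T := (p * x + c)%R.
have mphi : measurable_fun setT phi.
  by apply: measurable_funD => //; exact: measurable_funM.
pose push := measure_function_pushforward__canonical__measure_function_Measure
  mu mphi.
pose nu := mscale (NngNum (ltW p0)) push.
have E A : measurable A -> mu A = nu A.
  apply: lebesgue_measure_unique => _ [[a b]] _ <-.
  rewrite [RHS](_ : _ = p%:E * mu (phi @^-1` `]a, b]))//.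
  rewrite [phi @^-1` _](_ : _ =
      [set` `](a - c) / p, (b - c) / p]%R]); last first.
    apply/seteqP; split=> x /=; rewrite /phi !in_itv/= ltr_pdivrMr// ler_pdivlMr//.
      by move=> /andP[? ?]; apply/andP; split; rewrite (mulrC x); lra.
    by rewrite (mulrC x) => /andP[? ?]; apply/andP; split; lra.
  rewrite !lebesgue_measure_itv/= !lte_fin ltr_pM2r ?invr_gt0// ltrD2r.
  case: ifPn => _; last by rewrite mule0.
  by rewrite -!EFinB -EFinM; congr EFin; field; rewrite gt_eqF.
have -> : \int[mu]_x f x = \int[nu]_x f x.
  by apply: eq_measure_integral => A mA _; exact: E.
rewrite ge0_integral_mscale//.
have -> : \int[push]_x f x = \int[mu]_x f (phi x).
  rewrite ge0_integral_pushforward//=.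
by rewrite muleA -EFinM mulVf ?gt_eqF// mul1e.
Qed.
End cov1.

Section cV_integral.
Variable R : realType.
Local Open Scope ereal_scope.
Notation mu := (@lebesgue_measure R).
Notation T := (measurableTypeR R).

Definition col_of_tuple n (t : n.-tuple T) : 'cV[R]_n := \col_i tnth t i.

(** Measurability is tested through the parametrization by tuples, where the product measure
    lives. *)
Definition measurable_cV n d (S : measurableType d) (g : 'cV[R]_n -> S) :=
  measurable_fun [set: n.-tuple T] (g \o @col_of_tuple n).

Definition eintegral_cV n (g : 'cV[R]_n -> \bar R) : \bar R :=
  \int[power_measure mu n]_t g (col_of_tuple t).

(** [M] is rectangular so that linear functionals, given by a single row, are covered too. *)
Lemma measurable_cV_affine m n d (S : measurableType d) (g : 'cV[R]_m -> S)
    (M : 'M[R]_(m, n)) (a : 'cV[R]_m) :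
  measurable_cV g -> measurable_cV (fun x => g (M *m x + a)%R).
Proof.
move=> mg.
pose h (t : n.-tuple T) : m.-tuple T :=
  [tuple ((M *m col_of_tuple t + a) i 0)%R | i < m].
rewrite /measurable_cV (_ : _ \o _ = (g \o @col_of_tuple m) \o h); last first.
  apply/funext => t /=; congr g; apply/colP => i.
  by rewrite [RHS]mxE tnth_mktuple.
apply: measurableT_comp => //; apply/measurable_fun_tnthP => i.
rewrite (_ : _ \o _ = fun t : n.-tuple T => (\sum_j M i j * tnth t j + a i 0)%R).
  apply: measurable_funD => //; apply: measurable_sum => j.
  by apply: measurable_funM => //; exact: measurable_tnth.
apply/funext => t /=; rewrite tnth_mktuple !mxE; congr (_ + _)%R.
by apply: eq_bigr => j _; rewrite mxE.
Qed.

Lemma col_of_tcons n (q : T * n.-tuple T) :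
  col_of_tuple (tcons q) = col_mx (q.1%:M : 'cV_1) (col_of_tuple q.2) :> 'cV_(1 + n).
Proof.
apply/colP => i; rewrite [LHS]mxE.
case: (split_ordP i) => j ->.
  by rewrite col_mxEu ord1 [RHS]mxE /= mulr1n (tnth_nth 0%R) /=.
by rewrite col_mxEd [RHS]mxE !(tnth_nth 0%R).
Qed.

Lemma measurable_cV_pair n d (S : measurableType d) (g : 'cV[R]_(1 + n) -> S) :
  measurable_cV g ->
  measurable_fun setT (fun q : T * n.-tuple T => g (col_mx q.1%:M (col_of_tuple q.2))).
Proof.
move=> mg; rewrite (_ : (fun _ => _) = (g \o @col_of_tuple (1 + n)) \o @tcons _ _ n).
  by apply: measurableT_comp => //; exact: measurable_tcons.
by apply/funext => q /=; rewrite col_of_tcons.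
Qed.

Section step.
Variables (n : nat) (g : 'cV[R]_(1 + n) -> \bar R).
Hypotheses (mg : measurable_cV g) (g0 : forall x, 0 <= g x).

Lemma eintegral_cV_pair : eintegral_cV g =
  \int[mu \x power_measure mu n]_q g (col_mx q.1%:M (col_of_tuple q.2)).
Proof.
rewrite /eintegral_cV /= ge0_integral_pushforward//=.
- by rewrite preimage_setT; apply: eq_integral => q _ /=; rewrite col_of_tcons.
- exact: measurable_tcons.
Qed.

Lemma eintegral_cV_fst : eintegral_cV g =
  \int[mu]_x eintegral_cV (fun y : 'cV_n => g (col_mx x%:M y)).
Proof.
rewrite eintegral_cV_pair fubini_tonelli1//; exact: measurable_cV_pair.
Qed.

Lemma eintegral_cV_snd : eintegral_cV g =
  eintegral_cV (fun y : 'cV_n => integral mu setT (fun x : T => g (col_mx x%:M y))).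
Proof.
rewrite eintegral_cV_pair fubini_tonelli2//; exact: measurable_cV_pair.
Qed.

Lemma measurable_eintegral_fst :
  measurable_fun setT (fun x : T => eintegral_cV (fun y : 'cV_n => g (col_mx x%:M y))).
Proof.
apply: (measurable_fun_fubini_tonelli_F
  (fun q : T * n.-tuple T => g (col_mx q.1%:M (col_of_tuple q.2)))) => //.
exact: measurable_cV_pair.
Qed.

Lemma measurable_eintegral_snd :
  measurable_cV (fun y : 'cV_n => integral mu setT (fun x : T => g (col_mx x%:M y))).
Proof.
apply: (measurable_fun_fubini_tonelli_G (m1 := mu)
  (fun q : T * n.-tuple T => g (col_mx q.1%:M (col_of_tuple q.2)))) => //.
exact: measurable_cV_pair.
Qed.

Lemma measurable_slice_fst (y : 'cV[R]_n) :
  measurable_fun setT (fun x : T => g (col_mx x%:M y)).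
Proof.
pose z (x : T) : T * n.-tuple T := (x, [tuple (y i 0)%R | i < n]).
have mz : measurable_fun setT z by apply: measurable_fun_pair.
have := measurableT_comp (measurable_cV_pair mg) mz.
congr measurable_fun; apply/funext => x /=; congr (g (col_mx _ _)).
by apply/colP => i; rewrite mxE tnth_mktuple.
Qed.

Lemma measurable_slice_snd (x : R) :
  measurable_cV (fun y : 'cV[R]_n => g (col_mx x%:M y)).
Proof.
pose z (t : n.-tuple T) : T * n.-tuple T := (x, t).
have mz : measurable_fun setT z by apply: measurable_fun_pair.
exact: measurableT_comp (measurable_cV_pair mg) mz.
Qed.
End step.
End cV_integral.

(** * Affine change of variables in dimension n *)

Section cov.
Variable R : realType.
Local Open Scope ereal_scope.
Notation mu := (@lebesgue_measure R).
Notation T := (measurableTypeR R).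

Lemma eq_eintegral n (g h : 'cV[R]_n -> \bar R) :
  (forall x, g x = h x) -> eintegral_cV g = eintegral_cV h.
Proof. by move=> gh; apply: eq_integral => t _; rewrite gh. Qed.

Lemma eintegral_cVZ n (g : 'cV[R]_n -> \bar R) (k : R) : (0 <= k)%R ->
  measurable_cV g -> (forall x, 0 <= g x) ->
  eintegral_cV (fun x => k%:E * g x) = k%:E * eintegral_cV g.
Proof. by move=> k0 mg g0; rewrite /eintegral_cV ge0_integralZl_EFin. Qed.

(** The right factor changes only the first coordinate; the left one fixes it and acts on the others
    by the Schur complement, up to a shift depending on the first coordinate. Each factor is then
    within reach of Tonelli. *)
Lemma posdef_shear n (A : 'M[R]_(1 + n)) : A^T = A -> A 0%R 0%R != 0%R ->
  A = (block_mx 1%:M 0 ((A 0 0)^-1 *: dlsubmx A) (schur A) *m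
      block_mx (A 0 0)%:M (dlsubmx A)^T 0 1%:M)%R.
Proof.
move=> At p0; rewrite mulmx_block !mul1mx !mul0mx !mulmx1 !mulmx0 !addr0.
rewrite mul_mx_scalar scalerA mulfV// scale1r -scalemxAl addrC -schurK.
exact: posdef_block.
Qed.

Lemma mulmx_shear n (p : R) (v : 'cV[R]_n) (x : R) (y : 'cV[R]_n) :
  (block_mx p%:M v^T 0 1%:M *m col_mx x%:M y =
   col_mx (p * x + dotmx v y)%:M y)%R.
Proof.
rewrite mul_block_col mul0mx mul1mx add0r -scalar_mxM [(v^T *m y)%R]mx11_scalar.
by rewrite -raddfD.
Qed.

Lemma eintegral_affine n (A : 'M[R]_n) (a : 'cV[R]_n) (g : 'cV[R]_n -> \bar R) :
  posdef A -> measurable_cV g -> (forall x, 0 <= g x) ->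
  eintegral_cV (fun x => g (A *m x + a)%R) = ((\det A)^-1)%:E * eintegral_cV g.
Proof.
elim: n A a g => [|n IH]; [|rewrite -add1n]; move=> A a g pA mg g0.
  rewrite det_mx00 invr1 mul1e; apply: eq_eintegral => x; congr g.
  by apply/matrixP => -[].
have p0 := posdef_diag 0%R pA.
have pn0 : A 0%R 0%R != 0%R by rewrite gt_eqF.
have pS := posdef_schur pA; have S0 := posdef_det_gt0 pS.
have sA : (A^T = A)%R by case: pA.
pose p : R := A 0%R 0%R; pose v := @dlsubmx _ 1 n 1 n A; pose S := @schur R n A.
pose M : 'M[R]_(1 + n) := block_mx 1%:M 0 (p^-1 *: v)%R S.
have AE (x : T) (y : 'cV[R]_n) : (A *m col_mx x%:M y =
    M *m col_mx (p * x + dotmx v y)%:M y)%R.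
  by rewrite {1}(posdef_shear sA pn0) -mulmxA mulmx_shear.
have mgA : measurable_cV (fun x : 'cV_(1 + n) => g (A *m x + a)%R).
  exact: measurable_cV_affine.
have mgM : measurable_cV (fun x : 'cV_(1 + n) => g (M *m x + a)%R).
  exact: measurable_cV_affine.
have pV0 : (0 <= p^-1)%R by rewrite invr_ge0 ltW.
have SV0 : (0 <= (\det S)^-1)%R by rewrite invr_ge0 ltW.
(* Integrating first over the first coordinate, with [y] fixed, removes the right factor of the
   shear and produces [p^-1]. *)
transitivity (p^-1%:E * eintegral_cV (fun x : 'cV_(1 + n) => g (M *m x + a)%R)).
  rewrite (@eintegral_cV_snd _ n)// [in RHS](@eintegral_cV_snd _ n)//.
  rewrite -eintegral_cVZ//; last 2 first.
    exact: (measurable_eintegral_snd mgM).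
    by move=> y; exact: integral_ge0.
  apply: eq_eintegral => y.
  under eq_integral do rewrite AE.
  rewrite (@ge0_integral_affine _ (fun z : T => g (M *m col_mx z%:M y + a)%R))//.
  exact: (measurable_slice_fst mgM).
rewrite (@det_schur _ n)// invfM EFinM -muleA; congr (_ * _).
rewrite (@eintegral_cV_fst _ n)//.
pose G (z : T) := eintegral_cV (fun y : 'cV_n => g (col_mx z%:M y)).
have mG : measurable_fun setT G by exact: (measurable_eintegral_fst mg).
have G0 z : 0 <= G z by exact: integral_ge0.
pose a0 : R := a 0%R 0%R.
(* With [x] fixed, the other coordinates undergo [S] and a shift depending on [x], as the induction
   hypothesis allows. The first coordinate is only translated by [a0], written with slope 1 to fit
   [ge0_integral_affine]. *)
transitivity (\int[mu]_x ((\det S)^-1%:E * G (1 * x + a0)%R)).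
  apply: eq_integral => x _.
  rewrite -(IH S ((x / p) *: v + @dsubmx _ 1 n 1 a)%R)//; last first.
    exact: (measurable_slice_snd mg).
  apply: eq_eintegral => y; congr g.
  rewrite -[a in LHS](@vsubmxK _ 1 n) mul_block_col mul0mx addr0 mul1mx.
  rewrite add_col_mx; congr col_mx.
    rewrite mul1r [usubmx a]mx11_scalar -raddfD; congr (_ + _)%:M%R.
    by rewrite mxE /a0; congr (a _ _); exact/val_inj.
  rewrite mul_mx_scalar scalerA -addrA addrCA; congr (_ + _)%R.
rewrite ge0_integralZl_EFin//; last first.
  by apply: measurableT_comp => //; apply: measurable_funD => //; exact: measurable_funM.
rewrite ge0_integral_affine// invr1 mul1e; congr (_ * _).
by rewrite (@eintegral_cV_fst _ n).
Qed.

End cov.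

(** * The Euclidean norm and null sets *)

Section enorm.
Variable R : realType.

Lemma sqr_enorm n (x : 'cV[R]_n) : enorm x ^+ 2 = \sum_i x i 0 ^+ 2.
Proof. by rewrite sqr_sqrtr// sumr_ge0// => i _; exact: sqr_ge0. Qed.

Lemma enorm_ge0 n (x : 'cV[R]_n) : 0 <= enorm x.
Proof. exact: sqrtr_ge0. Qed.
Hint Resolve enorm_ge0 : core.

Lemma enormZ n c (x : 'cV[R]_n) : enorm (c *: x) = `|c| * enorm x.
Proof.
apply/eqP; rewrite -(@eqrXn2 _ 2) ?mulr_ge0// exprMn !sqr_enorm real_normK ?num_real//.
by apply/eqP; rewrite mulr_sumr; apply: eq_bigr => i _; rewrite mxE exprMn.
Qed.

Lemma enormN n (x : 'cV[R]_n) : enorm (- x) = enorm x.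
Proof. by rewrite -scaleN1r enormZ normrN1 mul1r. Qed.

Lemma enorm0 n : enorm (0 : 'cV[R]_n) = 0.
Proof. by rewrite -(scale0r (0 : 'cV[R]_n)) enormZ normr0 mul0r. Qed.

Lemma enorm_entry n (x : 'cV[R]_n) i : `|x i 0| <= enorm x.
Proof.
rewrite -(@ler_pXn2r _ 2) ?nnegrE// sqr_enorm real_normK ?num_real//.
by rewrite (bigD1 i)//= lerDl sumr_ge0// => j _; exact: sqr_ge0.
Qed.

Lemma dotmxE n (x y : 'cV[R]_n) : dotmx x y = \sum_i x i 0 * y i 0.
Proof. by rewrite /dotmx mxE; apply: eq_bigr => i _; rewrite mxE. Qed.

Lemma enorm_eq0 n (x : 'cV[R]_n) : enorm x = 0 -> x = 0.
Proof.
move=> x0; apply/colP => i; apply/eqP; rewrite mxE -normr_le0 -x0.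
exact: enorm_entry.
Qed.

Lemma dotmx_col_mx n (w : 'cV[R]_(1 + n)) (x : R) (y : 'cV[R]_n) :
  dotmx w (col_mx x%:M y) = w 0 0 * x + dotmx (dsubmx w) y.
Proof.
rewrite !dotmxE big_split_ord big_ord1 /= col_mxEu mxE mulr1n.
congr (w _ _ * _ + _); first exact/val_inj.
by apply: eq_bigr => i _; rewrite col_mxEd !mxE.
Qed.

(** Cauchy-Schwarz, from the expansion of the squared norm of [b x - a y] at [b = enorm y] and [a]
    equal to plus or minus [enorm x]. *)
Lemma dotmx_le n (x y : 'cV[R]_n) : `|dotmx x y| <= enorm x * enorm y.
Proof.
have lin (a b : R) : \sum_i (b * x i 0 - a * y i 0) ^+ 2 =
    b ^+ 2 * enorm x ^+ 2 + a ^+ 2 * enorm y ^+ 2 - 2 * a * b * dotmx x y.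
  rewrite !sqr_enorm dotmxE !mulr_sumr -sumrN -!big_split /=.
  by apply: eq_bigr => i _; ring.
have key (a b : R) : 0 <= b ^+ 2 * enorm x ^+ 2 + a ^+ 2 * enorm y ^+ 2 -
    2 * a * b * dotmx x y.
  by rewrite -lin sumr_ge0// => i _; exact: sqr_ge0.
have [/enorm_eq0 ->|x0] := eqVneq (enorm x) 0.
  by rewrite enorm0 mul0r dotmxE big1 ?normr0// => i _; rewrite mxE mul0r.
have [/enorm_eq0 ->|y0] := eqVneq (enorm y) 0.
  by rewrite enorm0 mulr0 dotmxE big1 ?normr0// => i _; rewrite mxE mulr0.
have ab : 0 < enorm x * enorm y by rewrite mulr_gt0// lt_neqAle eq_sym ?x0 ?y0/=.
rewrite ler_norml; apply/andP; split.
  by have := key (- enorm x) (enorm y); nra.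
by have := key (enorm x) (enorm y); nra.
Qed.

Lemma enormD n (x y : 'cV[R]_n) : enorm (x + y) <= enorm x + enorm y.
Proof.
rewrite -(@ler_pXn2r _ 2) ?nnegrE ?addr_ge0//.
have -> : enorm (x + y) ^+ 2 = enorm x ^+ 2 + enorm y ^+ 2 + 2 * dotmx x y.
  rewrite !sqr_enorm dotmxE !mulr_sumr -!big_split /=.
  by apply: eq_bigr => i _; rewrite mxE; ring.
by have := dotmx_le x y; rewrite ler_norml => /andP[_]; lra.
Qed.

Lemma enormB n (x y : 'cV[R]_n) : enorm (x - y) <= enorm x + enorm y.
Proof. by rewrite -[enorm y]enormN enormD. Qed.

Lemma enorm_distC n (x y : 'cV[R]_n) : enorm (x - y) = enorm (y - x).
Proof. by rewrite -enormN opprB. Qed.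

Lemma enorm_le_sum n (x : 'cV[R]_n) : enorm x <= \sum_i `|x i 0|.
Proof.
rewrite -(@ler_pXn2r _ 2) ?nnegrE ?sumr_ge0// sqr_enorm.
suff [] : 0 <= \sum_i `|x i 0| /\ \sum_i x i 0 ^+ 2 <= (\sum_i `|x i 0|) ^+ 2 by [].
elim/big_ind2 : _ => [|a b c e [b0 ab] [e0 ce]|i _].
- by rewrite expr0n.
- by split; [exact: addr_ge0|nra].
- by rewrite real_normK ?num_real.
Qed.

Lemma enorm_mulmx n (M : 'M[R]_n) (x : 'cV[R]_n) :
  enorm (M *m x) <= (\sum_i \sum_j `|M i j|) * enorm x.
Proof.
apply: le_trans (enorm_le_sum _) _; rewrite mulr_suml; apply: ler_sum => i _.
rewrite mxE mulr_suml; apply: le_trans (ler_norm_sum _ _ _) _.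
by apply: ler_sum => j _; rewrite normrM ler_wpM2l// enorm_entry.
Qed.

End enorm.
#[global] Hint Resolve enorm_ge0 : core.

Section monotone.
Variable R : realType.
Local Open Scope ereal_scope.

Import HBNNSimple.

(* Unlike [ge0_le_integral], without measurability of the larger function: that
   of [f] in the theorem is never needed. *)
Lemma le_integral_nonneg d (X : measurableType d) (m : {measure set X -> \bar R})
    (g h : X -> \bar R) : (forall x, 0 <= g x) -> (forall x, g x <= h x) ->
  \int[m]_x g x <= \int[m]_x h x.
Proof.
move=> g0 gh; have h0 x : 0 <= h x by exact: le_trans (g0 x) (gh x).
rewrite !ge0_integralTE//; apply: le_ereal_sup => _ [k kg <-]; exists k => // x.
exact: le_trans (kg x) (gh x).
Qed.

Lemma le_integral_cV n (g h : 'cV[R]_n -> R) : (forall x, 0 <= g x)%R ->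
  (forall x, g x <= h x)%R -> integral_cV g <= integral_cV h.
Proof.
by move=> g0 gh; apply: le_integral_nonneg => x; rewrite lee_fin.
Qed.

End monotone.

(** * Hyperplanes are null sets *)

Section hyperplane.
Variable R : realType.
Local Open Scope ereal_scope.
Notation mu := (@lebesgue_measure R).
Notation T := (measurableTypeR R).

(** The value [+oo] lets [H] dominate any function that vanishes off the hyperplane, bounded or
    not. *)
Let H n (w : 'cV[R]_n) c : 'cV[R]_n -> \bar R :=
  fun x => if dotmx w x == c then +oo else 0.

Let H0 n (w : 'cV[R]_n) c x : 0 <= H w c x.
Proof. by rewrite /H; case: ifP. Qed.

Let measurable_H n (w : 'cV[R]_n) c : measurable_cV (H w c).
Proof.
have mH : measurable_cV (fun x : 'cV[R]_1 => if x 0%R 0%R == c then +oo else 0 : \bar R).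
  apply: measurable_fun_ifT => //; apply: measurable_fun_eqr => //.
  rewrite (_ : (fun _ => _) = (fun t : 1.-tuple T => tnth t 0%R)); last first.
    by apply/funext => t; rewrite mxE.
  exact: measurable_tnth.
have := measurable_cV_affine (w^T)%R 0%R mH.
by congr measurable_fun; apply/funext => t /=; rewrite /H /dotmx addr0.
Qed.

(** Slice along the first coordinate. If the tail of [w] is nonzero, every slice is a hyperplane one
    dimension lower; otherwise only the slice over the single point [c / w 0 0] is nonempty. *)
Lemma integral_hyperplane n (w : 'cV[R]_n) c : w != 0%R ->
  eintegral_cV (fun x => if dotmx w x == c then +oo else 0) = 0.
Proof.
rewrite -[fun _ => _]/(H w c).
elim: n w c => [|n IH]; [|rewrite -add1n] => w c w0.
  by move: w0; rewrite (_ : w = 0%R) ?eqxx//; apply/matrixP => -[].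
rewrite eintegral_cV_fst//.
have Hcol (x : R) (y : 'cV[R]_n) : H w c (col_mx x%:M y) =
    H (dsubmx w) (c - w 0 0 * x)%R y.
  by rewrite /H dotmx_col_mx addrC eq_sym -subr_eq eq_sym.
have [w'0|w'0] := eqVneq (dsubmx w) 0%R; last first.
  apply: integral0_eq => x _.
  by rewrite (eq_eintegral (fun y => Hcol x y)) IH.
have w00 : w 0%R 0%R != 0%R.
  apply: contra_neq w0 => w00; rewrite -(vsubmxK w) w'0 [usubmx w]mx11_scalar.
  rewrite mxE (_ : w _ _ = 0%R) ?raddf0 ?col_mx0// -[RHS]w00.
  by congr (w _ _); exact/val_inj.
rewrite (_ : (fun _ => _) = (fun x : T => eintegral_cV
  (fun y : 'cV_n => H w c (col_mx x%:M y))) \_ [set c / w 0%R 0%R]%R).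
  by rewrite -integral_mkcond integral_set1.
apply/funext => x; rewrite patchE; case: ifPn => //; rewrite notin_setE /= => xc.
apply: integral0_eq => y _; rewrite Hcol /H w'0 /dotmx trmx0 mul0mx mxE.
case: ifP => // /eqP /esym /subr0_eq cx; exfalso; apply: xc.
by rewrite cx mulrC mulKf.
Qed.

End hyperplane.

(** * Ellipsoids and their volumes *)

Section bump.
Variable R : realType.
Notation mu := (@lebesgue_measure R).
Notation T := (measurableTypeR R).

(* [cap 0] is the indicator function of the closed ball, since [0 `^ 0 = 1]. *)
Definition cap n (s : R) (u : 'cV[R]_n) : R :=
  if enorm u <= 1 then Num.sqrt (1 - enorm u ^+ 2) `^ s else 0.

Lemma cap_ge0 n s (u : 'cV[R]_n) : 0 <= cap s u.
Proof. by rewrite /cap; case: ifP => // _; exact: powR_ge0. Qed.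

Lemma cap_le1 n s (u : 'cV[R]_n) : 0 <= s -> cap s u <= 1.
Proof.
move=> s0; rewrite /cap; case: ifP => // _.
rewrite -[leRHS](congr1 (@^~ s) (powR1 R)); apply: ge0_ler_powR; rewrite ?nnegrE//.
by rewrite -[leRHS]sqrtr1 ler_sqrt// lerBlDr lerDl sqr_ge0.
Qed.

Lemma cap0 n (u : 'cV[R]_n) : cap 0 u = if enorm u <= 1 then 1 else 0.
Proof. by rewrite /cap powRr0. Qed.

(** Outside the ball the square root is 0 by convention, and so is its power for [s > 0]. *)
Lemma cap_pos n s (u : 'cV[R]_n) : 0 < s ->
  cap s u = Num.sqrt (1 - enorm u ^+ 2) `^ s.
Proof.
move=> s0; rewrite /cap; case: ifPn => //; rewrite -ltNge => u1.
by rewrite ler0_sqrtr ?powR0 ?gt_eqF// subr_le0 exprn_ege1// ltW.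
Qed.

(** Powers with exponent at most 1 do not decrease numbers of [0, 1]. This lower bound is what makes
    the later estimates uniform in [s]. *)
Lemma cap_ge_half n s (u : 'cV[R]_n) : 0 <= s <= 1 -> enorm u <= 1 / 2 ->
  1 / 2 <= cap s u.
Proof.
move=> /andP[s0 s1] u2.
have u1 : enorm u <= 1 by apply: le_trans u2 _; lra.
rewrite /cap u1.
have h : 1 / 2 <= Num.sqrt (1 - enorm u ^+ 2).
  have -> : (1 / 2 : R) = Num.sqrt ((1 / 2) ^+ 2) by rewrite sqrtr_sqr ger0_norm.
  by apply: ler_wsqrtr; have := enorm_ge0 u; nra.
apply: (le_trans h); apply: ger1_powR => //; apply/andP; split; first lra.
by rewrite -[leRHS]sqrtr1 ler_sqrt// lerBlDr lerDl sqr_ge0.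
Qed.

Lemma measurable_enorm n : measurable_cV (@enorm R n : 'cV[R]_n -> T).
Proof.
rewrite /measurable_cV /enorm.
apply: (measurableT_comp (f := (@Num.sqrt R : T -> T))).
  by apply: continuous_measurable_fun; exact: sqrt_continuous.
apply: measurable_sum => i; apply: measurable_funX.
rewrite (_ : (fun _ => _) = (fun t : n.-tuple T => tnth t i)); last first.
  by apply/funext => t; rewrite mxE.
exact: measurable_tnth.
Qed.

Lemma measurable_cap n s : measurable_cV (cap s : 'cV[R]_n -> T).
Proof.
apply: measurable_fun_ifT => //.
  by apply: measurable_fun_ler => //; exact: measurable_enorm.
apply: (measurableT_comp (f := (@powR R ^~ s : T -> T))); first exact: measurable_powR.
apply: (measurableT_comp (f := (@Num.sqrt R : T -> T))).
  by apply: continuous_measurable_fun; exact: sqrt_continuous.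
apply: measurable_funB => //; apply: measurable_funX; exact: measurable_enorm.
Qed.

(** Cubes have an explicit product measure and bracket the ball, which shows that [kappa] is finite
    and positive. *)
Definition cube n (c : R) : set (n.-tuple T) := [set t | forall i, `|tnth t i| <= c].
Arguments cube : clear implicits.

Lemma measurable_cube n c : measurable (cube n c).
Proof.
rewrite (_ : cube n c = \bigcap_(i in [set: 'I_n]) [set t | `|tnth t i| <= c]).
  apply: fin_bigcap_measurable => // i _.
  rewrite -[X in measurable X]setTI.
  have : measurable_fun setT (fun t : n.-tuple T => `|tnth t i| <= c).
    apply: measurable_fun_ler => //; apply: measurableT_comp => //.
    exact: measurable_tnth.
  by move=> /(_ measurableT [set true]); apply.
by apply/seteqP; split => [t h i _|t h i]; apply: h.
Qed.

Lemma power_measure_cube n c : 0 <= c ->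
  power_measure mu n (cube n c) = ((2 * c) ^+ n)%:E.
Proof.
move=> c0; elim: n => [|n IH].
  by rewrite /= diracE expr0 mem_set// => -[].
rewrite /= /power_step /pushforward.
rewrite (_ : _ @^-1` _ = `[- c, c]%classic `*` cube n c); last first.
  apply/seteqP; split => [[x t] h|[x t] [/= xc h] i].
    split => /=.
      by have := h ord0; rewrite (tnth_nth 0)/= in_itv/= ler_norml.
    by move=> i; have := h (lift ord0 i); rewrite !(tnth_nth 0).
  case: (unliftP ord0 i) => [j ->|->]; last by rewrite (tnth_nth 0)/= ler_norml.
  by have := h j; rewrite !(tnth_nth 0).
rewrite product_measure1E//; last exact: measurable_cube.
rewrite IH exprS EFinM; congr (_ * _)%E.
transitivity (mu (`[- c, c]%classic : set R)); first by [].
rewrite lebesgue_measure_itv/= lte_fin.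
case: ltP => cc; first by rewrite -EFinB; congr EFin; ring.
by congr EFin; lra.
Qed.

Definition kappa n s : \bar R := integral_cV (@cap n s).

End bump.

(** * Volumes of ellipsoids and feasible parameters *)

Section kappa.
Variable R : realType.
Notation mu := (@lebesgue_measure R).
Notation T := (measurableTypeR R).

Lemma kappa_lty n s : 0 <= s -> (@kappa R n s < +oo)%E.
Proof.
move=> s0.
have /le_lt_trans : (@kappa R n s <=
    \int[power_measure mu n]_t (\1_(@cube R n 1) t)%:E)%E.
  apply: le_integral_nonneg => t; rewrite lee_fin ?cap_ge0//.
  rewrite indicE; case: (boolP (t \in _)) => [_|]; first exact: cap_le1.
  rewrite notin_setE => tc; rewrite /cap; case: ifPn => // t1; exfalso; apply: tc.
  move=> i; apply: le_trans t1; apply: le_trans (enorm_entry _ i).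
  by rewrite mxE.
apply; rewrite integral_indic//; last exact: measurable_cube.
rewrite setIT [X in (X < _)%E](power_measure_cube n ler01).
exact: ltry.
Qed.

Lemma kappa_gt0 n s : 0 <= s <= 1 -> (0 < @kappa R n s)%E.
Proof.
(* The norm is at most the sum of the [n] coordinates, so this cube lies in the ball of radius 1/2;
   [n.+1] keeps [c] positive when [n = 0]. *)
move=> s01; pose c : R := (2 * n.+1%:R)^-1.
have c0 : 0 < c by rewrite invr_gt0 mulr_gt0.
apply: (@lt_le_trans _ _
    (\int[power_measure mu n]_t ((1 / 2)%:E * (\1_(@cube R n c) t)%:E))%E).
  rewrite ge0_integralZl_EFin//; last first.
    by apply/measurable_EFinP; apply: measurable_indic; exact: measurable_cube.
  rewrite integral_indic//; last exact: measurable_cube.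
  rewrite setIT [X in (_ * X)%E](power_measure_cube n (ltW c0)) -EFinM lte_fin.
  rewrite mulr_gt0//.
  by rewrite exprn_gt0// mulr_gt0.
apply: le_integral_nonneg => t.
  by rewrite -EFinM lee_fin mulr_ge0.
rewrite -EFinM lee_fin indicE; case: (boolP (t \in _)) => [|_]; last first.
  by rewrite mulr0 cap_ge0.
rewrite inE mulr1 => tc; apply: cap_ge_half => //.
apply: le_trans (enorm_le_sum _) _.
apply: (@le_trans _ _ (\sum_(i < n) c)).
  by apply: ler_sum => i _; rewrite mxE.
rewrite sumr_const card_ord -[c *+ n]mulr_natl /c ler_pdivrMr ?mulr_gt0// mulrA.
by rewrite divfK// mul1r ler_nat.
Qed.

Lemma posdef_unit n (A : 'M[R]_n) : posdef A -> A \in unitmx.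
Proof. by move=> /posdef_det_gt0 A0; rewrite unitmxE unitfE gt_eqF. Qed.

Lemma integral_cVE n (g : 'cV[R]_n -> R) :
  integral_cV g = eintegral_cV (fun x => (g x)%:E).
Proof. by []. Qed.

(** Obtained from [eintegral_affine] for [A] itself, applied to the function composed with the
    inverse map, so that positive definiteness of [invmx A] does not have to be shown. *)
Lemma eintegral_affine_inv n (A : 'M[R]_n) a (g : 'cV[R]_n -> \bar R) :
  posdef A -> measurable_cV g -> (forall x, 0 <= g x)%E ->
  eintegral_cV (fun x => g (invmx A *m (x - a))) =
  ((\det A)%:E * eintegral_cV g)%E.
Proof.
move=> pA mg g0; have uA := posdef_unit pA; have dA := posdef_det_gt0 pA.
have E1 : eintegral_cV (fun x => g (invmx A *m (x - a))) =
    eintegral_cV (fun x => g (invmx A *m x + - (invmx A *m a))).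
  by apply: eq_eintegral => x; rewrite mulmxBr.
have E2 : eintegral_cV (fun u => g (invmx A *m (A *m u + a) + - (invmx A *m a))) =
    eintegral_cV g.
  by apply: eq_eintegral => u; rewrite mulmxDr addrK mulKmx.
have mh : measurable_cV (fun x : 'cV[R]_n => g (invmx A *m x + - (invmx A *m a))).
  exact: measurable_cV_affine.
have E3 := eintegral_affine a pA mh (fun x => g0 _).
rewrite E2 in E3; rewrite E1 E3 muleA -EFinM mulfV ?gt_eqF// mul1e.
by [].
Qed.

Lemma integral_bump n s beta (A : 'M[R]_n) a : 0 <= beta -> posdef A ->
  integral_cV (fun x => beta * cap s (invmx A *m (x - a))) =
  ((beta * \det A)%:E * kappa n s)%E.
Proof.
move=> b0 pA.
have mcE : measurable_cV (fun u : 'cV[R]_n => (cap s u)%:E).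
  by apply/measurable_EFinP; exact: measurable_cap.
have mbE : measurable_cV (fun u : 'cV[R]_n => (beta * cap s u)%:E).
  by apply/measurable_EFinP; apply: measurable_funM => //; exact: measurable_cap.
have cE0 (u : 'cV[R]_n) : (0 <= (cap s u)%:E)%E by rewrite lee_fin cap_ge0.
have bE0 (u : 'cV[R]_n) : (0 <= (beta * cap s u)%:E)%E.
  by rewrite lee_fin mulr_ge0 ?cap_ge0.
rewrite /kappa !integral_cVE.
have E1 := eintegral_affine_inv a pA mbE bE0.
have E2 := eintegral_cVZ b0 mcE cE0.
have E3 := etrans E1 (congr1 (mule _) E2).
by rewrite E3 muleA -EFinM mulrC.
Qed.

Lemma ellipsoidP n (A : 'M[R]_n) a x : posdef A ->
  ellipsoid A a x <-> enorm (invmx A *m (x - a)) <= 1.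
Proof.
move=> /posdef_unit uA; split => [[u u1 <-]|h].
  by rewrite addrK mulKmx.
by exists (invmx A *m (x - a)) => //; rewrite mulKVmx// subrK.
Qed.

Lemma mem_ellipsoid n (A : 'M[R]_n) a x : posdef A ->
  (x \in ellipsoid A a) = (enorm (invmx A *m (x - a)) <= 1).
Proof.
move=> pA; apply/idP/idP; first by rewrite inE => /(ellipsoidP _ _ pA).
by move=> h; rewrite inE; apply/(ellipsoidP _ _ pA).
Qed.

Lemma height_powR n s (A : 'M[R]_n) al a x : 0 < s -> 0 <= al -> posdef A ->
  height A al a x `^ s = al `^ s * cap s (invmx A *m (x - a)).
Proof.
move=> s0 al0 pA; rewrite /height mem_ellipsoid// /cap; case: ifP => _.
  by rewrite powRM.
by rewrite powR0 ?gt_eqF// mulr0.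
Qed.

Lemma s_volumeE n s (A : 'M[R]_n) al a : 0 < s -> 0 <= al -> posdef A ->
  s_volume s A al a = ((al `^ s * \det A)%:E * kappa n s)%E.
Proof.
move=> s0 al0 pA; rewrite /s_volume -(@integral_bump _ _ _ _ a)// ?powR_ge0//.
by apply: eq_integral => t _; rewrite height_powR.
Qed.

Lemma flat_funE n beta (A : 'M[R]_n) a x : posdef A ->
  flat_fun beta A a x = beta * cap 0 (invmx A *m (x - a)).
Proof.
by move=> pA; rewrite /flat_fun indicE mem_ellipsoid// cap0; case: ifP.
Qed.

Lemma integral_flat n beta (A : 'M[R]_n) a : 0 <= beta -> posdef A ->
  integral_cV (flat_fun beta A a) = ((beta * \det A)%:E * kappa n 0)%E.
Proof.
move=> b0 pA; rewrite -(@integral_bump _ _ _ _ a)//.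
by apply: eq_integral => t _; rewrite flat_funE.
Qed.

Definition feasible n (f : 'cV[R]_n -> R) s beta (A : 'M[R]_n) a : Prop :=
  [/\ 0 < beta, posdef A &
      forall u, enorm u <= 1 -> beta * cap s u <= f (A *m u + a)].

Section feasible.
Variables (n : nat) (f : 'cV[R]_n -> R).
Hypothesis f0 : forall x, 0 <= f x.

Lemma feasible_flat beta (A : 'M[R]_n) a : 0 < beta -> posdef A ->
  feasible f 0 beta A a <-> forall x, flat_fun beta A a x <= f x.
Proof.
move=> b0 pA; have uA := posdef_unit pA; split => [[_ _ h] x|h].
  rewrite (flat_funE _ _ _ pA) cap0; case: ifP => u1; last by rewrite mulr0.
  by have := h _ u1; rewrite cap0 u1 mulKVmx// subrK.
split => // u u1; have := h (A *m u + a).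
by rewrite (flat_funE _ _ _ pA) (addrK a) (mulKmx uA); exact.
Qed.

Lemma enorm_col_mx (u : 'cV[R]_n) (w : R) :
  enorm (col_mx u (w%:M : 'cV_1)) ^+ 2 = enorm u ^+ 2 + w ^+ 2.
Proof.
rewrite !sqr_enorm big_split_ord big_ord1 /=; congr (_ + _).
  by apply: eq_bigr => i _; rewrite col_mxEu.
by rewrite col_mxEd mxE eqxx mulr1n.
Qed.

Lemma ler_powR_inv (s x y : R) : 0 < s -> 0 <= x -> 0 <= y ->
  (x `^ s <= y) = (x <= y `^ s^-1).
Proof.
move=> s0 x0 y0; apply/idP/idP => h.
  have := ge0_ler_powR (r := s^-1) _ _ _ h.
  rewrite !nnegrE powR_ge0 y0 invr_ge0 (ltW s0) -powRrM mulfV ?gt_eqF// powRr1//.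
  exact.
have := ge0_ler_powR (r := s) _ _ _ h.
rewrite !nnegrE powR_ge0 x0 (ltW s0) -powRrM mulVf ?gt_eqF// powRr1//.
exact.
Qed.

(** Above the point [A *m u + a] the ellipsoid reaches height [al * sqrt (1 - |u|^2)], and the
    lifting condition need only be tested there. *)
Lemma feasible_lifting s (A : 'M[R]_n) al a : 0 < s -> 0 < al -> posdef A ->
  feasible f s (al `^ s) A a <-> dsym_ellipsoid A al a `<=` s_lifting f s.
Proof.
move=> s0 al0 pA; have uA := posdef_unit pA.
have prodE (u : 'cV[R]_n) (w : R) :
    block_mx A 0 0 al%:M *m col_mx u (w%:M : 'cV_1) + col_mx a 0 =
    col_mx (A *m u + a) (al * w)%:M.
  by rewrite mul_block_col !mul0mx addr0 add0r -scalar_mxM add_col_mx addr0.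
split => [[_ _ h] _ [w /= w1 <-]|h].
  rewrite /unit_ball /= in w1.
  rewrite -[w]vsubmxK [dsubmx w]mx11_scalar prodE /s_lifting /=.
  rewrite col_mxKd col_mxKu mxE eqxx mulr1n; set u := usubmx w; set om : R := dsubmx w 0 0.
  have uw : enorm u ^+ 2 + om ^+ 2 <= 1.
    rewrite -enorm_col_mx -mx11_scalar vsubmxK.
    by rewrite exprn_ile1 ?enorm_ge0.
  have u1 : enorm u <= 1.
    rewrite -(@expr_le1 _ 2) ?enorm_ge0//; apply: le_trans uw.
    by rewrite lerDl sqr_ge0.
  have al_ge0 := ltW al0.
  have := h _ u1; rewrite cap_pos// -powRM ?sqrtr_ge0// ler_powR_inv//; last first.
    by rewrite mulr_ge0 ?sqrtr_ge0.
  apply: le_trans; rewrite normrM (ger0_norm al_ge0) ler_wpM2l// -sqrtr_sqr.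
  by apply: ler_wsqrtr; rewrite lerBrDl.
split => //; first exact: powR_gt0.
move=> u u1; pose om := Num.sqrt (1 - enorm u ^+ 2).
have om2 : om ^+ 2 = 1 - enorm u ^+ 2.
  by rewrite sqr_sqrtr// subr_ge0 exprn_ile1 ?enorm_ge0.
have /h : dsym_ellipsoid A al a (col_mx (A *m u + a) (al * om)%:M).
  exists (col_mx u om%:M); last exact: prodE.
  rewrite /unit_ball/= -(@expr_le1 _ 2) ?enorm_ge0// enorm_col_mx om2.
  by lra.
rewrite /s_lifting /= col_mxKd col_mxKu mxE eqxx mulr1n.
have al_ge0 := ltW al0; have om0 : 0 <= om by exact: sqrtr_ge0.
rewrite (ger0_norm (mulr_ge0 al_ge0 om0)) -ler_powR_inv ?mulr_ge0//.
by rewrite cap_pos// powRM.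
Qed.

End feasible.
End kappa.

(** * Log-concave functions *)

Section log_concave.
Variables (R : realType) (n : nat) (f : 'cV[R]_n -> R).
Hypothesis flc : log_concave f.

Lemma log_concave_ge0 x : 0 <= f x.
Proof. by case: flc => psi [_ E]; rewrite -lee_fin E expeR_ge0. Qed.

(** Passage to real exponents: [psi] is finite where [f] is positive, and convexity keeps it finite
    in between. *)
Lemma log_concave_exp x y t : 0 < f x -> 0 < f y -> 0 <= t <= 1 ->
  exists p q r, [/\ f x = expR (- p), f y = expR (- q),
    f (t *: x + (1 - t) *: y) = expR (- r) & r <= t * p + (1 - t) * q].
Proof.
case: flc => psi [[psiN conv] E] fx fy t01.
have finite z : 0 < f z -> exists r, psi z = r%:E.
  move=> fz; have := E z; have := psiN z; case: (psi z) => [r| |] //.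
    by exists r.
  by move=> _ /= [fz0]; rewrite fz0 ltxx in fz.
have [p px] := finite _ fx; have [q qy] := finite _ fy.
have := conv x y t t01; rewrite px qy -!EFinM -EFinD.
have := E (t *: x + (1 - t) *: y); have := psiN (t *: x + (1 - t) *: y).
case: (psi (t *: x + (1 - t) *: y)) => [r| |] // _ Er; rewrite ?lee_fin// => rpq.
exists p, q, r; split => //.
- by have := E x; rewrite px => -[].
- by have := E y; rewrite qy => -[].
- by case: Er.
Qed.

Lemma log_concave_quasi c x y t : 0 <= t <= 1 -> c <= f x -> c <= f y ->
  c <= f (t *: x + (1 - t) *: y).
Proof.
move=> t01 cx cy; have [c0|c0] := leP c 0.
  exact: le_trans c0 (log_concave_ge0 _).
have [p [q [r [fx fy fz rpq]]]] :=
  log_concave_exp (lt_le_trans c0 cx) (lt_le_trans c0 cy) t01.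
rewrite fz; have [pq|pq] := leP p q.
  by apply: le_trans cy _; rewrite fy ler_expR lerN2; case/andP: t01; nra.
by apply: le_trans cx _; rewrite fx ler_expR lerN2; case/andP: t01; nra.
Qed.

Lemma log_concave_mid x y : f x * f y <= f (2^-1 *: x + 2^-1 *: y) ^+ 2.
Proof.
have [->|fx0] := eqVneq (f x) 0; first by rewrite mul0r sqr_ge0.
have [->|fy0] := eqVneq (f y) 0; first by rewrite mulr0 sqr_ge0.
have fx : 0 < f x by rewrite lt_neqAle eq_sym fx0 log_concave_ge0.
have fy : 0 < f y by rewrite lt_neqAle eq_sym fy0 log_concave_ge0.
have h2 : 0 <= (2^-1 : R) <= 1 by apply/andP; split; lra.
have [p [q [r [-> ->]]]] := log_concave_exp fx fy h2.
have -> : 1 - 2^-1 = 2^-1 :> R by lra.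
by move=> -> rpq; rewrite -expRD expr2 -expRD ler_expR; lra.
Qed.

End log_concave.

(** * Rank-one updates *)

Section rank_one.
Variable R : realType.

(** Matrix determinant lemma, by writing one block matrix as a lower times an upper triangular
    matrix and the other way round. *)
Lemma det_rank1 n (u v : 'cV[R]_n) : \det (1%:M + u *m v^T) = 1 + dotmx v u.
Proof.
have E : block_mx 1%:M 0 v^T 1%:M *m block_mx (1%:M + u *m v^T) u 0 1%:M =
  block_mx 1%:M u 0 (1%:M + v^T *m u) *m block_mx 1%:M 0 v^T 1%:M.
  rewrite !mulmx_block !mul1mx !mul0mx ?mulmx1 ?mulmx0 !addr0 !add0r.
  by rewrite mulmxDr mulmx1 mulmxDl mul1mx mulmxA addrC [v^T *m u + _]addrC.
have := congr1 (fun M => \det M) E.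
rewrite !det_mulmx !det_ublock !det_lblock !det1 !mulr1 !mul1r => ->.
by rewrite det_mx11 mxE mxE eqxx.
Qed.

Lemma qf_rank1 n (A : 'M[R]_n) c (w x : 'cV[R]_n) :
  qf (A + c *: (w *m w^T)) x = qf A x + c * dotmx w x ^+ 2.
Proof.
rewrite /qf mulmxDr mulmxDl mxE; congr (_ + _).
rewrite -scalemxAr -scalemxAl mxE; congr (_ * _).
rewrite mulmxA -[x^T *m w *m w^T *m x]mulmxA [x^T *m w]mx11_scalar.
rewrite mul_scalar_mx mxE expr2.
by congr (_ * _); rewrite -[w in LHS]trmxK -trmx_mul mxE.
Qed.

Lemma posdef_rank1 n (A : 'M[R]_n) c (w : 'cV[R]_n) : posdef A -> 0 <= c ->
  posdef (A + c *: (w *m w^T)).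
Proof.
move=> [At Ap] c0; split.
  by rewrite linearD /= linearZ /= trmx_mul trmxK At.
move=> x x0; rewrite -/(qf _ x) qf_rank1 ltr_wpDr ?Ap//.
by rewrite mulr_ge0// sqr_ge0.
Qed.

Lemma posdef_scale n (A : 'M[R]_n) c : posdef A -> 0 < c -> posdef (c *: A).
Proof.
move=> [At Ap] c0; split; first by rewrite linearZ /= At.
by move=> x x0; rewrite -scalemxAr -scalemxAl mxE mulr_gt0// Ap.
Qed.

Lemma posdef1 n : posdef (1%:M : 'M[R]_n).
Proof.
split; first exact: trmx1.
move=> x x0; rewrite mulmx1 -/(dotmx x x) dotmxE.
rewrite (eq_bigr (fun i => x i 0 ^+ 2)); last by move=> i _; rewrite expr2.
rewrite -sqr_enorm exprn_gt0// lt_neqAle enorm_ge0 andbT eq_sym.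
by apply: contra_neq x0; exact: enorm_eq0.
Qed.

End rank_one.

(** * A ball in a superlevel set, and the mass bound *)

Section bounds.
Variables (R : realType) (n : nat) (f : 'cV[R]_n -> R).
Hypothesis fp : proper_log_concave f.

Let f0 x : 0 <= f x. Proof. by case: fp => flc _ _; exact: log_concave_ge0. Qed.

Let flc : log_concave f. Proof. by case: fp. Qed.

Lemma not_in_hyperplane (w : 'cV[R]_n) c : w != 0 ->
  exists x, 0 < f x /\ dotmx w x != c.
Proof.
move=> w0; apply: contrapT => nex.
case: fp => _ _ /andP[]; rewrite ltNge => /negP + _; apply.
rewrite -(integral_hyperplane c w0) integral_cVE.
apply: le_integral_nonneg => t; first by rewrite lee_fin.
case: ifPn => [_|tc]; first exact: leey.
rewrite lee_fin leNgt; apply/negP => ft; apply: nex.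
by exists (col_of_tuple t).
Qed.

(** Dimension 0 has no nonzero [w], so this is not a case of [not_in_hyperplane]. *)
Lemma positive_point : exists x, 0 < f x.
Proof.
apply: contrapT => nex.
case: fp => _ _ /andP[]; rewrite ltNge => /negP + _; apply.
rewrite (_ : integral_cV f = 0)%E// integral_cVE.
apply: integral0_eq => t _; congr EFin; apply/eqP; rewrite eq_le f0 andbT leNgt.
by apply/negP => ft; apply: nex; exists (col_of_tuple t).
Qed.

(** As long as [k < n], some [w] is orthogonal to all rows found so far; a point of positive value
    off the hyperplane through [p] normal to [w] gives an independent new row. *)
Lemma free_points p k : (k <= n)%N ->
  exists M : 'M[R]_(k, n), row_free M /\ forall i, 0 < f (p + (row i M)^T).
Proof.
elim: k => [_|k IH kn].
  by exists 0; split; [rewrite /row_free mxrank0|case].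
have [M [Mfree Mpos]] := IH (ltnW kn).
have [w [w0 Mw]] : exists w : 'cV[R]_n, w != 0 /\ M *m w = 0.
  have : cokermx M != 0.
    rewrite -mxrank_eq0 mxrank_coker subn_eq0 -ltnNge.
    exact: leq_ltn_trans (rank_leq_row M) kn.
  move=> /eqP/matrixP K.
  have [j Kj] : exists j, col j (cokermx M) != 0.
    apply: contrapT => nex; apply: K => i j; rewrite mxE.
    have [/colP/(_ i)|cj] := eqVneq (col j (cokermx M)) 0; first by rewrite !mxE.
    by exfalso; apply: nex; exists j.
  exists (col j (cokermx M)); split => //.
  by rewrite colE mulmxA mulmx_coker mul0mx.
have [x [fx wx]] := not_in_hyperplane (dotmx w p) w0.
have xpw : ((x - p)^T *m w) 0 0 = dotmx w x - dotmx w p.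
  rewrite mxE !dotmxE -sumrB; apply: eq_bigr => i _; rewrite !mxE; ring.
suff [N [NF NP]] : exists N : 'M[R]_(1 + k, n),
  row_free N /\ forall i, 0 < f (p + (row i N)^T) by exists N.
exists (col_mx (x - p)^T M); split.
  (* Pairing a linear relation with [w] kills the rows of [M], so the coefficient of the new row is
     0. *)
  apply: (@inj_row_free _ (1 + k)) => v; rewrite -[v]hsubmxK mul_row_col => v0.
  have v1 : lsubmx v = 0.
    have := congr1 (fun z => z *m w) v0; rewrite mulmxDl -!mulmxA Mw mulmx0 addr0 mul0mx.
    rewrite [lsubmx v]mx11_scalar mul_scalar_mx => /matrixP /(_ 0 0).
    rewrite mxE xpw [in RHS]mxE => /eqP; rewrite mulf_eq0 subr_eq0 (negbTE wx) orbF.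
    by move=> /eqP ->; rewrite raddf0.
  move: v0; rewrite v1 mul0mx add0r => v0.
  by rewrite (row_free_inj Mfree (etrans v0 (esym (mul0mx _ M)))) row_mx0.
move=> i; case: (split_ordP i) => j ->.
  rewrite rowKu ord1 (_ : row 0 _ = (x - p)^T) ?trmxK; last exact: row_id.
  by rewrite addrC subrK.
by rewrite rowKd.
Qed.

(** The weight missing from [\sum_i t i] sits on the vertex [p]. Split off one vertex and rescale
    the other weights by [(1 - t ord0)^-1], which forces a separate case [t ord0 = 1]. *)
Lemma simplex_in_superlevel m p k (q : 'I_k -> 'cV[R]_n) (t : 'I_k -> R) :
  m <= f p -> (forall i, m <= f (p + q i)) -> (forall i, 0 <= t i) ->
  \sum_i t i <= 1 -> m <= f (p + \sum_i t i *: q i).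
Proof.
move=> mp; elim: k q t => [|k IH] q t mq t0 t1; first by rewrite big_ord0 addr0.
rewrite big_ord_recl; move: t1; rewrite big_ord_recl.
set t' := fun i => t (lift ord0 i) => t1.
have t'0 : 0 <= \sum_i t' i by rewrite sumr_ge0// => i _; exact: t0.
have [e|ne] := eqVneq (t ord0) 1.
  have z i : t' i = 0.
    have : \sum_i t' i = 0.
      by apply/eqP; rewrite eq_le t'0 andbT; move: t1; rewrite e; lra.
    move=> /eqP; rewrite psumr_eq0 => [|j _]; last exact: t0.
    by move=> /allP/(_ i (mem_index_enum _))/eqP.
  rewrite big1 ?addr0 ?e ?scale1r// => i _.
  by rewrite -/(t' i) z scale0r.
have c0 : 0 < 1 - t ord0.
  by rewrite subr_gt0 lt_neqAle ne /=; lra.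
have := IH (fun i => q (lift ord0 i)) (fun i => (1 - t ord0)^-1 * t' i) _ _ _.
move=> /(_ (fun i => mq _) (fun i => mulr_ge0 _ (t0 _))) IH'.
have h : m <= f (p + \sum_i ((1 - t ord0)^-1 * t' i) *: q (lift ord0 i)).
  apply: IH'; first by rewrite invr_ge0 ltW.
  by rewrite -mulr_sumr mulrC ler_pdivrMr// mul1r; lra.
have := log_concave_quasi flc (t := t ord0) _ (mq ord0) h.
set a := f _; set b := f _; suff -> : a = b.
  by apply; rewrite t0 /=; lra.
rewrite /a /b; congr f; rewrite scalerDr scalerDr addrACA -scalerDl.
have -> : t ord0 + (1 - t ord0) = 1 by ring.
rewrite scale1r; congr (_ + (_ + _)).
rewrite scaler_sumr; apply: eq_bigr => i _; rewrite scalerA mulrA mulfV ?mul1r//.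
by rewrite gt_eqF.
Qed.


Lemma ball_in_superlevel : exists p r m, [/\ 0 < r, 0 < m &
  forall u, enorm u <= r -> m <= f (p + u)].
Proof.
have [p fp0] := positive_point.
have [M [Mfree Mpos]] := free_points p (leqnn n).
have uM : M^T \in unitmx by rewrite unitmx_tr -row_free_unit.
pose m := \big[Num.min/f p]_i f (p + (row i M)^T).
have m0 : 0 < m.
  rewrite /m; elim/big_ind : _ => // x y x0 y0.
  by rewrite lt_min x0 y0.
have mp : m <= f p by exact: bigmin_le_id.
have mq i : m <= f (p + (row i M)^T) by exact: bigmin_le_cond.
(* The center of the ball has all weights equal to [b]. A perturbation of size at most [b] leaves
   them in [[0, 2 * b]], with sum at most [n / (n + 1)]. *)
pose b : R := (2 * n.+1%:R)^-1.
have b0 : 0 < b by rewrite invr_gt0 mulr_gt0.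
pose C := 1 + \sum_i \sum_j `|(invmx M^T) i j|.
have C0 : 0 < C.
  by rewrite ltr_pwDl// sumr_ge0// => i _; rewrite sumr_ge0.
exists (p + M^T *m const_mx b), (b / C), m; split => //; first exact: divr_gt0.
move=> u ur; pose w := invmx M^T *m u.
have wb i : `|w i 0| <= b.
  apply: le_trans (enorm_entry _ _) _; apply: le_trans (enorm_mulmx _ _) _.
  apply: (@le_trans _ _ (C * enorm u)); first by apply: ler_wpM2r; rewrite ?enorm_ge0 ?lerDr.
  by rewrite mulrC -ler_pdivlMr.
have -> : p + M^T *m const_mx b + u = p + \sum_i (b + w i 0) *: (row i M)^T.
  rewrite -addrA; congr (_ + _).
  have -> : u = M^T *m w by rewrite mulKVmx.
  rewrite -mulmxDr; apply/colP => j; rewrite mxE summxE.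
  by apply: eq_bigr => i _; rewrite !mxE mulrC.
apply: simplex_in_superlevel => //.
  by move=> i; have := wb i; rewrite ler_norml => /andP[]; lra.
apply: (@le_trans _ _ (\sum_(i < n) (2 * b))).
  by apply: ler_sum => i _; have := wb i; rewrite ler_norml => /andP[_]; lra.
rewrite sumr_const card_ord -[(2 * b) *+ n]mulr_natl.
have -> : 2 * b = n.+1%:R^-1 by rewrite /b invfM mulVKf.
by rewrite ler_pdivrMr// mul1r ler_nat.
Qed.

(** The integral of [f] in units of the volume of the unit ball. *)
Definition mass := fine (integral_cV f) / fine (@kappa R n 0).

Lemma feasible0_mass b A a : feasible f 0 b A a -> b * \det A <= mass.
Proof.
move=> fe; have [b0 pA _] := fe.
have := (feasible_flat f0 a b0 pA).1 fe => h.
have : (integral_cV (flat_fun b A a) <= integral_cV f)%E.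
  apply: le_integral_cV => // x.
  by rewrite (flat_funE _ _ _ pA) mulr_ge0 ?cap_ge0// ltW.
case: fp => _ _ /andP[I0 Ioo].
have h01 : 0 <= (0 : R) <= 1 by rewrite lexx ler01.
have k0 : 0 < fine (@kappa R n 0).
  by apply: fine_gt0; rewrite kappa_gt0//= kappa_lty.
rewrite (integral_flat _ (ltW b0) pA) /mass ler_pdivlMr//.
have kfin : @kappa R n 0 \is a fin_num.
  by rewrite ge0_fin_numE ?kappa_lty// ltW// kappa_gt0.
rewrite -(fineK kfin) -[integral_cV f]fineK; last by rewrite ge0_fin_numE// ltW.
by rewrite -EFinM lee_fin.
Qed.

End bounds.

(** * Boundedness of the function and of its superlevel sets *)

Section superlevel_bounds.
Variables (R : realType) (n : nat) (f : 'cV[R]_n -> R).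
Hypothesis fp : proper_log_concave f.

Let f0 x : 0 <= f x. Proof. by case: fp => flc _ _; exact: log_concave_ge0. Qed.

Let flc : log_concave f. Proof. by case: fp. Qed.

Lemma feasible0I b (A : 'M[R]_n) a : 0 < b -> posdef A ->
  (forall u, enorm u <= 1 -> b <= f (A *m u + a)) -> feasible f 0 b A a.
Proof. by move=> b0 pA h; split=> // u u1; rewrite cap0 u1 mulr1; exact: h. Qed.

Lemma sqrt_le_mid x y c : 0 <= c -> c <= f x * f y ->
  Num.sqrt c <= f (2^-1 *: x + 2^-1 *: y).
Proof.
move=> c0 h; rewrite -[leRHS](ger0_norm (f0 _)) -sqrtr_sqr; apply: ler_wsqrtr.
exact: le_trans h (log_concave_mid flc x y).
Qed.

(** The midpoints of [x] with the points of the fixed ball form a ball of half the radius, on which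
    [f >= sqrt (m * f x)]; the mass bounds this height. *)
Lemma log_concave_bounded : exists M, forall x, f x <= M.
Proof.
have [p [r [m [r0 m0 ball]]]] := ball_in_superlevel fp.
pose Q := mass f / (r / 2) ^+ n.
exists (Q ^+ 2 / m) => x; have [fx|fx] := leP (f x) 0.
  by apply: le_trans fx _; rewrite divr_ge0 ?sqr_ge0// ltW.
have r20 : 0 < r / 2 by rewrite divr_gt0.
have mfx : 0 < m * f x by rewrite mulr_gt0.
have pA : posdef ((r / 2) *: 1%:M : 'M[R]_n) by apply: posdef_scale => //; exact: posdef1.
have := feasible0_mass fp (@feasible0I (Num.sqrt (m * f x)) _ (2^-1 *: (p + x)) _ pA _).
rewrite detZ det1 mulr1 sqrtr_gt0 => /(_ mfx) h.
have {}h : Num.sqrt (m * f x) <= Q.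
  rewrite /Q ler_pdivlMr ?exprn_gt0//; apply: h => u u1.
  have -> : (r / 2) *: 1%:M *m u + 2^-1 *: (p + x) =
      2^-1 *: (p + r *: u) + 2^-1 *: x.
    by rewrite -scalemxAl mul1mx !scalerDr scalerA addrCA addrA [2^-1 * r]mulrC.
  apply: sqrt_le_mid; first exact: ltW.
  rewrite ler_pM2r//; apply: ball; rewrite enormZ gtr0_norm// -[leRHS]mulr1.
  by rewrite ler_pM2l.
have h0 := sqrtr_ge0 (m * f x).
have := ler_pM h0 h0 h h; rewrite -!expr2 sqr_sqrtr; last exact: ltW.
by rewrite ler_pdivlMr// mulrC.
Qed.

(* The convex hull of [x] and the ball of radius [r] about [p] contains the
   ellipsoid centred at the midpoint of [p] and [x], with semi-axes of order
   [|x - p|] along [x - p] and of order [r] in the orthogonal directions. *)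
Lemma superlevel_bounded eps : 0 < eps ->
  exists D, forall x, eps <= f x -> enorm x <= D.
Proof.
move=> eps0; have [p [r [m [r0 m0 ball]]]] := ball_in_superlevel fp.
pose e := Num.min m eps; have e0 : 0 < e by rewrite lt_min m0.
(* The weight [1 - t] of the ball will be at least 1/4, so that [rho / (1 - t) <= r]. *)
pose rho := r / 4; have rho0 : 0 < rho by rewrite divr_gt0.
have ern : 0 < e * rho ^+ n by rewrite mulr_gt0// exprn_gt0.
exists (4 * rho * (mass f / (e * rho ^+ n)) + enorm p) => x ex.
have -> : x = (x - p) + p by rewrite subrK.
apply: le_trans (enormD _ _) _; rewrite lerD2r.
pose w := x - p; rewrite -/w.
have [w0|w0] := eqVneq (enorm w) 0.
  rewrite w0 mulr_ge0//; first by rewrite mulr_ge0// ltW.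
  rewrite divr_ge0 ?ltW//; have pA : posdef (rho *: 1%:M : 'M[R]_n).
    by apply: posdef_scale => //; exact: posdef1.
  have := feasible0_mass fp (@feasible0I m _ p m0 pA _).
  rewrite detZ det1 mulr1 => h; apply: lt_le_trans (h _).
    by rewrite mulr_gt0// exprn_gt0.
  move=> u u1; rewrite addrC; apply: ball; rewrite -scalemxAl mul1mx enormZ gtr0_norm//.
  apply: (@le_trans _ _ (rho * 1)); first by rewrite ler_pM2l.
  by rewrite /rho mulr1; lra.
have {}w0 : 0 < enorm w by rewrite lt_neqAle eq_sym w0 enorm_ge0.
(* This makes the displacement along [w] at most a quarter of [w], hence [t] lies in [1/4, 3/4],
   while [\det A] still grows linearly in [enorm w]. *)
pose c := (4 * enorm w)^-1; have c0 : 0 < c by rewrite invr_gt0 mulr_gt0.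
pose A := rho *: 1%:M + c *: (w *m w^T).
have pA : posdef A.
  by apply: posdef_rank1 (ltW c0); apply: posdef_scale => //; exact: posdef1.
have dA : \det A = rho ^+ n * (1 + enorm w / (4 * rho)).
  have -> : A = rho *: (1%:M + ((c / rho) *: w) *m w^T).
    rewrite /A scalerDr -scalemxAl scalerA; congr (_ + _ *: _).
    by rewrite mulrC divfK// gt_eqF.
  rewrite detZ det_rank1; congr (_ * (1 + _)).
  rewrite dotmxE (eq_bigr (fun i => (c / rho) * w i 0 ^+ 2)); last first.
    by move=> i _; rewrite [((c / rho) *: w) i 0]mxE; ring.
  rewrite -mulr_sumr -sqr_enorm /c; field.
  by rewrite gt_eqF// gt_eqF.
have := feasible0_mass fp (@feasible0I e _ (2^-1 *: (p + x)) e0 pA _).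
rewrite dA mulrA => h.
have {}h : e * rho ^+ n * (1 + enorm w / (4 * rho)) <= mass f.
  apply: h => u u1.
  pose d := c * dotmx w u.
  have d4 : `|d| <= 1 / 4.
    rewrite normrM (gtr0_norm c0) /c ler_pdivrMl ?mulr_gt0//.
    apply: le_trans (dotmx_le _ _) _.
    by have : enorm w * enorm u <= enorm w * 1; [rewrite ler_pM2l|lra].
  pose t := 2^-1 + d.
  have /andP[t1 t2] : 1 / 4 <= t <= 3 / 4.
    by move: d4; rewrite ler_norml /t => /andP[? ?]; apply/andP; split; lra.
  have t3 : 0 < 1 - t by lra.
  have -> : A *m u + 2^-1 *: (p + x) =
      t *: x + (1 - t) *: (p + (rho / (1 - t)) *: u).
    rewrite /A mulmxDl -!scalemxAl mul1mx -mulmxA [w^T *m u]mx11_scalar.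
    rewrite mul_mx_scalar scalerA -/(dotmx w u) -/d [in RHS]scalerDr [in RHS]scalerA.
    have -> : (1 - t) * (rho / (1 - t)) = rho by rewrite mulrC divfK// gt_eqF.
    rewrite /t /w; apply/colP => i; rewrite !mxE; lra.
  apply: (log_concave_quasi flc).
  - by apply/andP; split; lra.
  - by apply: le_trans ex; rewrite ge_min lexx orbT.
  - apply: (@le_trans _ _ m); first by rewrite ge_min lexx.
    apply: ball; rewrite enormZ gtr0_norm ?divr_gt0//.
    have h1 : rho / (1 - t) <= r by rewrite ler_pdivrMr// /rho; nra.
    by rewrite -[leRHS]mulr1 ler_pM// ?enorm_ge0// divr_ge0// ltW.
have : 1 + enorm w / (4 * rho) <= mass f / (e * rho ^+ n).
  by rewrite ler_pdivlMr// mulrC.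
set Q := mass f / _ => hQ.
have : enorm w / (4 * rho) <= Q by lra.
by rewrite ler_pdivrMr ?mulr_gt0// mulrC.
Qed.

End superlevel_bounds.

(** * A priori bounds on feasible parameters *)

Section feasible_bounds.
Variables (R : realType) (n : nat) (f : 'cV[R]_n -> R).
Hypothesis fp : proper_log_concave f.

Let f0 x : 0 <= f x. Proof. by case: fp => flc _ _; exact: log_concave_ge0. Qed.

Lemma feasible_le_half s b (A : 'M[R]_n) a u : 0 <= s <= 1 ->
  feasible f s b A a -> enorm u <= 1 / 2 -> b / 2 <= f (A *m u + a).
Proof.
move=> s01 [b0 pA h] u2; have u1 : enorm u <= 1 by apply: le_trans u2 _; lra.
apply: le_trans (h _ u1); rewrite ler_pM2l//.
by have := cap_ge_half s01 u2; lra.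
Qed.

(* Averaging the points of the ellipsoid with a fixed point of positive value
   replaces the height [b] by [sqrt (m * b / 2)], at the cost of a fixed factor
   in the volume; as the mass of [f] is finite, [b] cannot be too small. *)
Lemma feasible_height_lb v : 0 < v -> exists b0, 0 < b0 /\
  forall s b (A : 'M[R]_n) a, 0 <= s <= 1 -> feasible f s b A a ->
    v <= b * \det A -> b0 <= b.
Proof.
move=> v0; have [p fp0] := positive_point fp.
(* [4 ^+ n] pays for two halvings, of the ball and by the midpoint; the added 1 makes [K]
   positive. *)
pose K := (mass f + 1) * 4 ^+ n.
have mass_ge0 : 0 <= mass f.
  rewrite /mass divr_ge0// fine_ge0// ?integral_ge0// => t _; rewrite lee_fin//.
  exact: cap_ge0.
have K0 : 0 < K by rewrite mulr_gt0 ?exprn_gt0// ltr_wpDl.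
have fpv : 0 < f p * v ^+ 2 by rewrite mulr_gt0// exprn_gt0.
have K2 : 0 < 2 * K ^+ 2 by rewrite mulr_gt0// exprn_gt0.
(* This solves [(q * v)^2 <= (K * b)^2] for [b], given [q^2 = f p * b / 2]. *)
exists (f p * v ^+ 2 / (2 * K ^+ 2)); split; first exact: divr_gt0.
move=> s b A a s01 fe vb; have [b0 pA _] := fe.
have pA4 : posdef (4^-1 *: A) by apply: posdef_scale => //; rewrite invr_gt0.
pose q := Num.sqrt (f p * (b / 2)).
have q2 : q ^+ 2 = f p * (b / 2) by rewrite sqr_sqrtr// mulr_ge0// ltW// divr_gt0.
have q0 : 0 < q by rewrite sqrtr_gt0 mulr_gt0// divr_gt0.
have hq : q * (4 ^- n * \det A) <= mass f.
  rewrite -exprVn -detZ.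
  apply: (feasible0_mass fp (a := 2^-1 *: p + 2^-1 *: a)).
  apply: feasible0I => // u u1.
  have -> : 4^-1 *: A *m u + (2^-1 *: p + 2^-1 *: a) =
      2^-1 *: p + 2^-1 *: (A *m (2^-1 *: u) + a).
    rewrite scalerDr -scalemxAl -scalemxAr scalerA addrCA; congr (_ + (_ *: _ + _)).
    by rewrite -invfM; congr (_^-1); lra.
  apply: (sqrt_le_mid fp); first by rewrite mulr_ge0// ltW// divr_gt0.
  rewrite ler_pM2l//; apply: (feasible_le_half s01 fe).
  by rewrite enormZ ger0_norm//; lra.
have dA := posdef_det_gt0 pA.
have hK : q * \det A <= K.
  have e4 : 0 < 4 ^+ n :> R by rewrite exprn_gt0.
  have : q * \det A = q * (4 ^- n * \det A) * 4 ^+ n.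
    by move: (4 ^+ n) e4 => e e4; field; rewrite gt_eqF.
  move=> ->; rewrite /K ler_pM2r//; lra.
have qv : q * v <= K * b.
  apply: (@le_trans _ _ (q * \det A * b)); last by rewrite ler_pM2r.
  by rewrite -mulrA [\det A * b]mulrC ler_pM2l.
have h : (q * v) ^+ 2 <= (K * b) ^+ 2.
  by rewrite !expr2 ler_pM// mulr_ge0// ltW.
rewrite ler_pdivrMr//.
have e1 : (q * v) ^+ 2 = b * (f p * v ^+ 2 / 2) by rewrite exprMn q2; lra.
have e2 : (K * b) ^+ 2 = b * (b * K ^+ 2) by ring.
by move: h; rewrite e1 e2 ler_pM2l//; lra.
Qed.

(** Once [b >= b0], the image of the half ball lies in the superlevel set of [f] at [b0 / 2], which
    is bounded; its center gives [a], and the images of the halved basis vectors give the columns of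
    [A]. *)
Lemma feasible_bounds v : 0 < v -> exists b0 C, 0 < b0 /\
  forall s b (A : 'M[R]_n) a, 0 <= s <= 1 -> feasible f s b A a ->
    v <= b * \det A ->
    [/\ b0 <= b, b <= C, forall i j, `|A i j| <= C & forall i, `|a i 0| <= C].
Proof.
move=> v0; have [b0 [b00 lb]] := feasible_height_lb v0.
have [M fM] := log_concave_bounded fp.
have [|D fD] := superlevel_bounded fp (eps := b0 / 2); first exact: divr_gt0.
exists b0, (Num.max M (4 * Num.max D 0)); split => // s b A a s01 fe vb.
have bb := lb _ _ _ _ s01 fe vb; have [bpos pA h] := fe.
have hD u : enorm u <= 1 / 2 -> enorm (A *m u + a) <= Num.max D 0.
  move=> u2; apply: (@le_trans _ _ D); last by rewrite le_max lexx.
  apply: fD; apply: le_trans (feasible_le_half s01 fe u2); lra.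
have aD : enorm a <= Num.max D 0.
  have := hD 0; rewrite mulmx0 add0r enorm0; apply; lra.
have D0 : 0 <= Num.max D 0 by rewrite le_max lexx orbT.
split => //.
- rewrite le_max; apply/orP; left; apply: le_trans (fM a).
  have e0 : enorm (0 : 'cV[R]_n) <= 1 by rewrite enorm0.
  have := h 0 e0; rewrite mulmx0 add0r /cap e0 enorm0 expr0n subr0 sqrtr1 powR1.
  by rewrite mulr1.
- move=> i j; rewrite le_max; apply/orP; right.
  have e2 : enorm (2^-1 *: delta_mx j 0 : 'cV[R]_n) <= 1 / 2.
    rewrite enormZ ger0_norm//.
    suff : enorm (delta_mx j 0 : 'cV[R]_n) <= 1 by lra.
    rewrite -(@expr_le1 _ 2) ?enorm_ge0// sqr_enorm (bigD1 j)//= mxE !eqxx expr1n.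
    rewrite big1 ?addr0// => k kj; rewrite mxE (negbTE kj) expr0n//.
  have Aj : `|(A *m (2^-1 *: (delta_mx j 0 : 'cV[R]_n))) i 0| <= 2 * Num.max D 0.
    apply: le_trans (enorm_entry _ _) _.
    rewrite -[_ *m _](addrK a); apply: le_trans (enormB _ _) _.
    by have := hD _ e2; lra.
  move: Aj; rewrite -scalemxAr mxE -colE mxE normrM ger0_norm//; lra.
- move=> i; rewrite le_max; apply/orP; right.
  by apply: le_trans (enorm_entry _ _) _; lra.
Qed.

End feasible_bounds.

(** * Limits along ultrafilters *)

Section limits.
Variable R : realType.

Definition cvg_mx T (F : set_system T) m n (A_ : T -> 'M[R]_(m, n)) (A : 'M[R]_(m, n)) :=
  forall i j, A_ t i j @[t --> F] --> A i j.

(** Compactness of a segment gives a cluster point, and an ultrafilter converges to its cluster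
    points. *)
Lemma ultra_cvg T (F : set_system T) (h : T -> R) C : UltraFilter F ->
  (\forall t \near F, `|h t| <= C) -> exists l : R, h t @[t --> F] --> l.
Proof.
move=> UF hC.
have FF : ProperFilter (h @ F) by apply: fmap_proper_filter.
have [|l [_ cl]] := @segment_compact R (- C) C (h @ F) FF.
  by apply: filterS hC => t; rewrite /= in_itv /= ler_norml.
exists l => U lU.
have [//|FnU] := in_ultra_setVsetC (h @^-1` U) UF.
by have [x [nUx Ux]] := cl (~` U) U FnU lU.
Qed.

Lemma cvg_det T (F : set_system T) {FF : Filter F} n (A_ : T -> 'M[R]_n) A :
  cvg_mx F A_ A -> \det (A_ t) @[t --> F] --> \det A.
Proof.
move=> AA; apply: (cvg_big (op := +%R)); first exact: add_continuous.
move=> s _; apply: cvgM; first exact: cvg_cst.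
have mc : continuous (fun x : R * R => x.1 * x.2) by exact: mul_continuous.
by apply: (cvg_big mc) => i _; exact: AA.
Qed.

Lemma cvg_mulmx T (F : set_system T) {FF : Filter F} m n p
    (A_ : T -> 'M[R]_(m, n)) A (u_ : T -> 'M[R]_(n, p)) u :
  cvg_mx F A_ A -> cvg_mx F u_ u -> cvg_mx F (fun t => A_ t *m u_ t) (A *m u).
Proof.
move=> AA uu i j; rewrite mxE; under eq_fun do rewrite mxE.
apply: (cvg_big (op := +%R)); first exact: add_continuous.
by move=> k _; apply: cvgM; [exact: AA|exact: uu].
Qed.

Lemma cvg_addmx T (F : set_system T) {FF : Filter F} m n
    (A_ B_ : T -> 'M[R]_(m, n)) A B :
  cvg_mx F A_ A -> cvg_mx F B_ B -> cvg_mx F (fun t => A_ t + B_ t) (A + B).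
Proof.
move=> AA BB i j; rewrite mxE; under eq_fun do rewrite mxE.
by apply: cvgD; [exact: AA|exact: BB].
Qed.

Lemma cvg_mx_cst T (F : set_system T) {FF : Filter F} m n (A : 'M[R]_(m, n)) :
  cvg_mx F (fun=> A) A.
Proof. by move=> i j; exact: cvg_cst. Qed.

Lemma cvg_mx_nbhs T (F : set_system T) {FF : Filter F} m n
    (A_ : T -> 'M[R]_(m, n)) (A : 'M[R]_(m, n)) :
  cvg_mx F A_ A -> A_ t @[t --> F] --> A.
Proof.
move=> AA; apply/cvg_ballP => e e0.
have h : \forall t \near F, forall i j, ball (A i j) e (A_ t i j).
  apply: filter_forall => i; apply: filter_forall => j.
  by have /cvg_ballP := AA i j; apply.
by apply: filterS h => t ht; split.
Qed.

Lemma usc_limit T (F : set_system T) {FF : ProperFilter F} n (f : 'cV[R]_n -> R)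
    (x_ : T -> 'cV[R]_n) x (g : T -> R) l : upper_semicontinuous f ->
  cvg_mx F x_ x -> g t @[t --> F] --> l ->
  (\forall t \near F, g t <= f (x_ t)) -> l <= f x.
Proof.
move=> usc xx gl gf; rewrite leNgt; apply/negP => fl.
pose b := (f x + l) / 2.
have fb : f x < b by rewrite /b; lra.
have bl : b < l by rewrite /b; lra.
have h1 : \forall t \near F, f (x_ t) < b.
  have xn : x_ t @[t --> F] --> x by apply: cvg_mx_nbhs.
  exact: xn _ (usc x b fb).
have h2 : \forall t \near F, b < g t by exact: cvgr_gt gl _ bl.
have [t [[t1 t2] t3]] := filter_ex (filterI (filterI h1 h2) gf).
lra.
Qed.

Lemma cvg_powR T (F : set_system T) {FF : Filter F} (s_ : T -> R) s c : 0 < c ->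
  s_ t @[t --> F] --> s -> c `^ s_ t @[t --> F] --> c `^ s.
Proof.
move=> c0 ss; rewrite /powR gt_eqF//.
have sc : s_ t * ln c @[t --> F] --> s * ln c by apply: cvgM => //; exact: cvg_cst.
exact: (cvg_comp _ _ sc (@continuous_expR R _)).
Qed.

(** The open ball matters: on the sphere the base of the power is 0, and its power jumps to 1 at
    exponent 0. *)
Lemma cvg_cap T (F : set_system T) {FF : Filter F} n (u : 'cV[R]_n) (s_ : T -> R) s :
  enorm u < 1 -> s_ t @[t --> F] --> s -> cap (s_ t) u @[t --> F] --> cap s u.
Proof.
move=> u1 ss; rewrite /cap (ltW u1); apply: cvg_powR => //.
by rewrite sqrtr_gt0 subr_gt0 expr_lt1 ?enorm_ge0.
Qed.

(** On the sphere [cap s] vanishes if [s > 0]; if [s = 0], the point is approached radially and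
    upper semicontinuity concludes. *)
Lemma feasible_open n (f : 'cV[R]_n -> R) s b A a : (forall x, 0 <= f x) ->
  upper_semicontinuous f -> 0 <= s -> 0 < b -> posdef A ->
  (forall u, enorm u < 1 -> b * cap s u <= f (A *m u + a)) -> feasible f s b A a.
Proof.
move=> f0 usc s0 b0 pA h; split => // u u1.
have [u1'|u1'] := ltP (enorm u) 1; first exact: h.
have ue : enorm u = 1 by apply/eqP; rewrite eq_le u1 u1'.
have [sE|sn] := eqVneq s 0; last first.
  by rewrite /cap ue lexx expr1n subrr sqrtr0 powR0// mulr0.
rewrite sE cap0 u1 mulr1.
apply: (@usc_limit _ (0:R)^'+ _ _ _ (fun t => A *m ((1 - t) *: u) + a) _ (fun=> b) _ usc).
- apply: cvg_addmx; last exact: cvg_mx_cst.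
  apply: cvg_mulmx; first exact: cvg_mx_cst.
  move=> i j; under eq_fun do rewrite mxE.
  have : (1 - t) * u i j @[t --> (0 : R)^'+] --> (1 - 0) * u i j.
    apply: cvgM; last exact: cvg_cst.
    apply: cvgB; first exact: cvg_cst.
    by apply: cvg_at_right_filter; exact: cvg_id.
  by rewrite subr0 mul1r.
- exact: cvg_cst.
- near=> t.
  have t0 : 0 < t by near: t; exact: nbhs_right_gt.
  have t1 : t < 1 by near: t; exact: nbhs_right_lt.
  have tu : enorm ((1 - t) *: u) < 1.
    by rewrite enormZ ue mulr1 gtr0_norm; lra.
  by have := h _ tu; rewrite sE cap0 (ltW tu) mulr1.
Unshelve. all: by end_near.
Qed.

(** The limit is symmetric and positive semidefinite, and a semidefinite form vanishes at [x] only
    if [A *m x = 0]. *)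
Lemma posdef_limit n T (F : set_system T) {FF : ProperFilter F}
    (A_ : T -> 'M[R]_n) (A : 'M[R]_n) : cvg_mx F A_ A ->
  (\forall t \near F, posdef (A_ t)) -> \det A != 0 -> posdef A.
Proof.
move=> AA pA dA.
have At : A^T = A.
  apply/matrixP => i j; rewrite mxE.
  apply: (@cvg_unique _ _ (A_ t i j @[t --> F])) => //; last exact: AA.
  apply: cvg_trans (AA j i); apply: near_eq_cvg; apply: filterS pA => t [At _].
  by rewrite -{1}At mxE.
have Age0 x : 0 <= qf A x.
  have c : cvg_mx F (fun t => x^T *m A_ t *m x) (x^T *m A *m x).
    apply: cvg_mulmx; last exact: cvg_mx_cst.
    by apply: cvg_mulmx => //; exact: cvg_mx_cst.
  apply: (cvgr_to_ge (c 0 0)); apply: filterS pA => t [_ pt].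
  have [->|x0] := eqVneq x 0; last by rewrite ltW// pt.
  by rewrite mulmx0 mxE.
split => // x x0; rewrite -/(qf A x) lt_neqAle Age0 andbT eq_sym.
apply: contra_neq x0 => qx.
have Ax : A *m x = 0.
  apply/colP => i; rewrite [RHS]mxE.
  set y : 'cV[R]_n := delta_mx i 0.
  have expand t : qf A (x + t *: y) = qf A x + 2 * t * (A *m x) i 0 + t ^+ 2 * qf A y.
    have xAy : (x^T *m A *m y) 0 0 = (A *m x) i 0.
      by rewrite /y -colE mxE -[A in LHS]At -trmx_mul mxE.
    have yAx : (y^T *m A *m x) 0 0 = (A *m x) i 0.
      by rewrite /y trmx_delta -mulmxA -rowE mxE.
    have -> : qf A (x + t *: y) = ((x^T + t *: y^T) *m A *m (x + t *: y)) 0 0.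
      by rewrite /qf; congr ((_ *m _ *m _) _ _); rewrite linearD linearZ.
    rewrite /qf !mulmxDl !mulmxDr -!scalemxAl -!scalemxAr.
    move: xAy yAx; move: ((A *m x) i 0) (x^T *m A *m x) (x^T *m A *m y).
    move: (y^T *m A *m x) (y^T *m A *m y) => P1 P2 c P3 P4 e1 e2.
    by rewrite !mxE e1 e2; ring.
  have /= key t := Age0 (x + t *: y); set c := (A *m x) i 0 in expand *.
  have qy := Age0 y.
  have {}key t : 0 <= 2 * t * c + t ^+ 2 * qf A y.
    by have := key t; rewrite expand qx add0r.
  apply/eqP; rewrite -sqrf_eq0 eq_le sqr_ge0 andbT.
  have d0 : 0 < qf A y + 1 by lra.
  (* A value of [t] at which the polynomial is a negative multiple of [c ^+ 2]; the added 1 covers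
     [qf A y = 0]. *)
  have := key (- c / (qf A y + 1)).
  set z := qf A y in qy d0 *.
  have -> : 2 * (- c / (z + 1)) * c + (- c / (z + 1)) ^+ 2 * z =
    - (c ^+ 2 * ((z + 2) / (z + 1) ^+ 2)).
    by field; rewrite gt_eqF.
  rewrite oppr_ge0 pmulr_lle0//.
  by rewrite divr_gt0 ?exprn_gt0//; lra.
have uA : A \in unitmx by rewrite unitmxE unitfE.
by rewrite -(mulKmx uA x) Ax mulmx0.
Qed.

End limits.

(** * Maximizers *)

Section maximizers.
Variables (R : realType) (n : nat) (f : 'cV[R]_n -> R).
Hypothesis fp : proper_log_concave f.

Let f0 x : 0 <= f x. Proof. by case: fp => flc _ _; exact: log_concave_ge0. Qed.

Let flc : log_concave f. Proof. by case: fp. Qed.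

Let fusc : upper_semicontinuous f. Proof. by case: fp. Qed.

(** The bound [v] passes to the limit and keeps the limit determinant nonzero, so that the matrices
    cannot degenerate. *)
Lemma feasible_limit T (F : set_system T) (s_ b_ : T -> R) (A_ : T -> 'M[R]_n)
    (a_ : T -> 'cV[R]_n) s v : UltraFilter F -> 0 < v -> s_ t @[t --> F] --> s ->
  (\forall t \near F, [/\ 0 <= s_ t <= 1, feasible f (s_ t) (b_ t) (A_ t) (a_ t) &
     v <= b_ t * \det (A_ t)]) ->
  exists b A a, [/\ feasible f s b A a, b_ t @[t --> F] --> b,
    cvg_mx F A_ A & cvg_mx F a_ a].
Proof.
move=> UF v0 ss near_f.
have PF : ProperFilter F by exact: ultra_proper.
have [b0 [C [b00 bnd]]] := feasible_bounds fp v0.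
have near_b : \forall t \near F, [/\ b0 <= b_ t, b_ t <= C,
    forall i j, `|A_ t i j| <= C & forall i, `|a_ t i 0| <= C].
  by apply: filterS near_f => t [st ft vt]; exact: bnd st ft vt.
have [b bb] : exists b : R, b_ t @[t --> F] --> b.
  apply: (ultra_cvg (C := C)); apply: filterS near_b => t [bt bC _ _].
  by rewrite ger0_norm//; apply: le_trans bt; exact: ltW.
have [A AA] : exists A : 'M[R]_n, cvg_mx F A_ A.
  have h (ij : 'I_n * 'I_n) : exists l : R, A_ t ij.1 ij.2 @[t --> F] --> l.
    by apply: (ultra_cvg (C := C)); apply: filterS near_b => t [_ _ + _]; apply.
  have [l hl] := choice h.
  by exists (\matrix_(i, j) l (i, j)) => i j; rewrite mxE; exact: (hl (i, j)).
have [a aa] : exists a : 'cV[R]_n, cvg_mx F a_ a.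
  have h (i : 'I_n) : exists l : R, a_ t i 0 @[t --> F] --> l.
    by apply: (ultra_cvg (C := C)); apply: filterS near_b => t [_ _ _]; apply.
  have [l hl] := choice h.
  by exists (\col_i l i) => i j; rewrite mxE (ord1 j); exact: (hl i).
have bpos : 0 < b.
  apply: (lt_le_trans b00); apply: (cvgr_to_ge bb).
  by apply: filterS near_b => t [].
have bA : v <= b * \det A.
  apply: (cvgr_to_ge (cvgM bb (cvg_det AA))).
  by apply: filterS near_f => t [].
have pA : posdef A.
  apply: (posdef_limit AA); first by apply: filterS near_f => t [_ [_ ? _] _].
  apply/eqP => A0; move: bA; rewrite A0 mulr0; lra.
have s0 : 0 <= s.
  by apply: (cvgr_to_ge ss); apply: filterS near_f => t [/andP[]].
exists b, A, a; split => //; apply: feasible_open => // u u1.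
apply: (@usc_limit _ _ F _ _ f (fun t => A_ t *m u + a_ t) _
  (fun t => b_ t * cap (s_ t) u)) => //.
- by apply: cvg_addmx => //; apply: cvg_mulmx => //; exact: cvg_mx_cst.
- by apply: cvgM => //; exact: cvg_cap.
- by apply: filterS near_f => t [_ [_ _ h] _]; apply: h; exact: ltW.
Qed.

Lemma feasible_mono s b (A : 'M[R]_n) a : 0 <= s -> feasible f 0 b A a ->
  feasible f s b A a.
Proof.
move=> s0 [b0 pA h]; split => // u u1; apply: le_trans (h u u1).
by rewrite ler_pM2l// cap0 u1 cap_le1.
Qed.

Lemma feasible_exists s : 0 <= s -> exists b A a, feasible f s b A a.
Proof.
move=> s0; have [p [r [m [r0 m0 ball]]]] := ball_in_superlevel fp.
exists m, (r *: 1%:M), p; apply: feasible_mono => //.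
apply: feasible0I => // [|u u1]; first by apply: posdef_scale => //; exact: posdef1.
rewrite addrC; apply: ball; rewrite -scalemxAl mul1mx enormZ gtr0_norm//.
by rewrite -[leRHS]mulr1 ler_pM2l.
Qed.

Definition maximal s b (A : 'M[R]_n) a := feasible f s b A a /\
  forall b' A' a', feasible f s b' A' a' -> b' * \det A' <= b * \det A.

(** The sets of feasible parameters at least as good as a given one are nested, hence form a filter
    base. Along an ultrafilter refining it, [val] eventually exceeds each feasible value, so the
    limit is a maximizer. *)
Lemma maximal_exists s : 0 <= s <= 1 -> exists b A a, maximal s b A a.
Proof.
move=> s01; have /andP[s0 s1] := s01.
pose P := (R * 'M[R]_n * 'cV[R]_n)%type.
pose val (E : P) := E.1.1 * \det E.1.2.
pose D : set P := [set E | feasible f s E.1.1 E.1.2 E.2].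
pose S (E : P) : set P := [set E' | D E' /\ val E <= val E'].
have [b1 [A1 [a1 fe1]]] := feasible_exists s0.
have D1 : D (b1, A1, a1) by [].
have FF : ProperFilter (filter_from D S).
  apply: filter_from_proper; last by move=> E DE; exists E.
  apply: filter_from_filter; first by exists (b1, A1, a1).
  move=> E E' DE DE'; have [EE'|EE'] := leP (val E) (val E').
    by exists E' => // E'' [D'' h]; split; split => //; exact: le_trans EE' h.
  by exists E => // E'' [D'' h]; split; split => //; exact: le_trans (ltW EE') h.
have [G [UG FG]] := ultraFilterLemma FF.
have PG : ProperFilter G by exact: ultra_proper.
have v0 : 0 < val (b1, A1, a1).
  by case: fe1 => b10 pA1 _; rewrite mulr_gt0// posdef_det_gt0.
have GS E : D E -> G (S E) by move=> DE; apply: FG; exists E.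
have [|b [A [a [fe bb AA _]]]] :=
  @feasible_limit P G (fun=> s) (fun E => E.1.1) (fun E => E.1.2) (fun E => E.2)
    s _ UG v0 (cvg_cst s).
  by apply: filterS (GS _ D1) => E [].
exists b, A, a; split => // b' A' a' fe'.
apply: (cvgr_to_ge (cvgM bb (cvg_det AA))).
by apply: filterS (GS (b', A', a') fe') => E [].
Qed.

(* If two maximizers differ in the matrix, their midpoint has a larger
   determinant; if they differ only in the centre, the convex hull of the two
   translates contains an ellipsoid elongated along the translation vector. *)
Lemma maximal0_unique b A a b' A' a' : maximal 0 b A a -> maximal 0 b' A' a' ->
  [/\ b = b', A = A' & a = a'].
Proof.
move=> [fe M] [fe' M']; have [b0 pA h] := fe; have [b0' pA' h'] := fe'.
have vE : b * \det A = b' * \det A'.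
  by apply/eqP; rewrite eq_le (M' _ _ _ fe) (M _ _ _ fe').
have dA := posdef_det_gt0 pA; have dA' := posdef_det_gt0 pA'.
have hh u : enorm u <= 1 -> b <= f (A *m u + a).
  by move=> u1; have := h u u1; rewrite cap0 u1 mulr1.
have hh' u : enorm u <= 1 -> b' <= f (A' *m u + a').
  by move=> u1; have := h' u u1; rewrite cap0 u1 mulr1.
pose N := 2^-1 *: A + 2^-1 *: A'.
have qN x : qf A x + qf A' x <= 2 * qf N x.
  rewrite /N /qf !mulmxDr !mulmxDl -!scalemxAr -!scalemxAl.
  move: (x^T *m A *m x) (x^T *m A' *m x) => B B'; rewrite !mxE; lra.
have pN : posdef N.
  split; first by rewrite /N linearD !linearZ /=; case: pA => ->; case: pA' => ->.
  move=> x x0; have := qN x; rewrite -/(qf N x).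
  have := pA.2 x x0; have := pA'.2 x x0; rewrite -/(qf A x) -/(qf A' x); lra.
have dN := posdef_det_gt0 pN.
have [le_det eq_det] := det_midpoint pA pA' pN qN.
pose c := Num.sqrt (b * b').
have bb0 : 0 < b * b' by rewrite mulr_gt0.
have c0 : 0 < c by rewrite sqrtr_gt0.
have feN : feasible f 0 c N (2^-1 *: a + 2^-1 *: a').
  apply: feasible0I => // u u1.
  have -> : N *m u + (2^-1 *: a + 2^-1 *: a') =
      2^-1 *: (A *m u + a) + 2^-1 *: (A' *m u + a').
    by rewrite mulmxDl -!scalemxAl addrACA -!scalerDr.
  apply: (sqrt_le_mid fp); first exact: ltW.
  by rewrite ler_pM ?hh ?hh'// ltW.
have hN := M _ _ _ feN.
have hN2 : (c * \det N) ^+ 2 <= (b * \det A) ^+ 2.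
  by rewrite !expr2 ler_pM// mulr_ge0// ltW.
have c2 : c ^+ 2 = b * b' by rewrite sqr_sqrtr// ltW.
(* Optimality gives [c * \det N <= b * \det A]; squaring, with [c ^+ 2 = b * b'] and [vE], yields
   the converse of [le_det]. *)
have eqA : \det A * \det A' = \det N ^+ 2.
  apply/eqP; rewrite eq_le le_det /= -(ler_pM2l bb0) -{1}c2 -exprMn.
  apply: (le_trans hN2); rewrite {1}expr2 {2}vE; lra.
have [AN A'N] := eq_det eqA.
have AA' : A = A' by rewrite AN A'N.
have bE : b = b' by move: vE; rewrite AA' => /mulIf; apply; rewrite gt_eqF.
split => //; apply: contrapT => aa'.
pose w := 2^-1 *: (a - a').
have w0 : w != 0.
  apply/eqP => /eqP; rewrite scaler_eq0 invr_eq0 pnatr_eq0 /= subr_eq0.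
  by move/eqP.
have ew : 0 < enorm w.
  rewrite lt_neqAle enorm_ge0 andbT eq_sym; apply: contra_neq w0.
  exact: enorm_eq0.
pose B := A + (enorm w)^-1 *: (w *m w^T).
have wV : 0 < (enorm w)^-1 by rewrite invr_gt0.
have pB : posdef B by apply: posdef_rank1 => //; exact: ltW.
have dB := posdef_det_gt0 pB.
have feB : feasible f 0 b B (2^-1 *: (a + a')).
  apply: feasible0I => // u u1.
  (* Moving from the midpoint of the centers by [d] times [w], with [d] in [-1, 1], is averaging [a]
     and [a'] with weight [t = (1 + d) / 2]. *)
  pose t := (1 + (enorm w)^-1 * dotmx w u) / 2.
  have d1 : `|(enorm w)^-1 * dotmx w u| <= 1.
    rewrite normrM gtr0_norm// ler_pdivrMl// mulr1.
    by apply: le_trans (dotmx_le w u) _; rewrite -[leRHS]mulr1 ler_pM2l.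
  have t01 : 0 <= t <= 1.
    by move: d1; rewrite ler_norml /t => /andP[? ?]; apply/andP; split; lra.
  have -> : B *m u + 2^-1 *: (a + a') =
      t *: (A *m u + a) + (1 - t) *: (A' *m u + a').
    rewrite -AA' /B mulmxDl -scalemxAl -mulmxA [w^T *m u]mx11_scalar mul_mx_scalar.
    rewrite -/(dotmx w u) scalerA /t.
    move: (A *m u) ((enorm w)^-1 * dotmx w u) => z d.
    by apply/colP => i; rewrite !mxE; lra.
  apply: (log_concave_quasi flc t01); first exact: hh.
  by rewrite bE; exact: hh'.
have qB x : qf A x + qf A x <= 2 * qf B x.
  rewrite qf_rank1; have : 0 <= (enorm w)^-1 * dotmx w x ^+ 2.
    by rewrite mulr_ge0 ?sqr_ge0// ltW.
  lra.
(* Used with equal first two matrices, this is strict monotonicity of the determinant; optimality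
   then forces [A = B], contradicting [w != 0]. *)
have [leB eqB] := det_midpoint pA pA pB qB.
have := M _ _ _ feB; rewrite ler_pM2l// => BA.
have [] : A = B /\ A = B.
  apply: eqB; apply/eqP; rewrite eq_le leB /= !expr2 ler_pM//; exact: ltW.
rewrite /B => /eqP; rewrite eq_sym -subr_eq0 addrC addKr => /eqP wwT _.
have := congr1 (fun Z => (w^T *m Z *m w) 0 0) wwT.
have := qf_rank1 0 (enorm w)^-1 w w; rewrite add0r /qf => ->.
rewrite mulmx0 !mul0mx mxE add0r => /eqP.
rewrite mulf_eq0 invr_eq0 gt_eqF//= sqrf_eq0 dotmxE.
rewrite (eq_bigr (fun i => w i 0 ^+ 2)); last by move=> i _; rewrite expr2.
by rewrite -sqr_enorm sqrf_eq0 gt_eqF.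
Qed.

End maximizers.

(** * John ellipsoids *)

Section John.
Variables (R : realType) (n : nat) (f : 'cV[R]_n -> R).
Hypothesis fp : proper_log_concave f.

Let f0 x : 0 <= f x. Proof. by case: fp => flc _ _; exact: log_concave_ge0. Qed.

Lemma le_mul_kappa s (x y : R) : 0 <= s <= 1 ->
  (x%:E * @kappa R n s <= y%:E * @kappa R n s)%E = (x <= y).
Proof.
move=> s01; have /andP[s0 _] := s01.
have k0 := kappa_gt0 n s01; have koo := @kappa_lty R n s s0.
have kfin : @kappa R n s \is a fin_num by rewrite ge0_fin_numE// ltW.
have kf : 0 < fine (@kappa R n s) by apply: fine_gt0; rewrite k0 koo.
by rewrite -(fineK kfin) -!EFinM lee_fin ler_pM2r.
Qed.

Lemma John_maximal s (A : 'M[R]_n) al a : 0 < s <= 1 ->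
  is_John_s_ellipsoid f s A al a -> maximal f s (al `^ s) A a.
Proof.
move=> /andP[s0 s1] [pA al0 sub M]; split; first exact/(feasible_lifting f0).
move=> b B c fe; have [b0 pB _] := fe.
pose be := b `^ s^-1; have be0 : 0 < be by rewrite powR_gt0.
have bE : be `^ s = b by rewrite -powRrM mulVf ?gt_eqF// powRr1// ltW.
have /(M _ _ _ pB be0) : dsym_ellipsoid B be c `<=` s_lifting f s.
  by apply/(feasible_lifting f0) => //; rewrite bE.
rewrite (s_volumeE c s0 (ltW be0) pB) (s_volumeE a s0 (ltW al0) pA) bE.
by rewrite le_mul_kappa// (ltW s0).
Qed.

Lemma maximal_John s b (A : 'M[R]_n) a : 0 < s <= 1 ->
  maximal f s b A a -> is_John_s_ellipsoid f s A (b `^ s^-1) a.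
Proof.
move=> /andP[s0 s1] [fe M]; have [b0 pA _] := fe.
have al0 : 0 < b `^ s^-1 by rewrite powR_gt0.
have bE : (b `^ s^-1) `^ s = b by rewrite -powRrM mulVf ?gt_eqF// powRr1// ltW.
split; [exact: pA|exact: al0|by apply/(feasible_lifting f0); rewrite ?bE|].
move=> B be c pB be0 /(feasible_lifting f0) => /(_ s0 be0 pB) /M h.
rewrite (s_volumeE c s0 (ltW be0) pB) (s_volumeE a s0 (ltW al0) pA) bE.
by rewrite le_mul_kappa// (ltW s0).
Qed.

(** Existence of a maximizer ensures that [get] returns an actual John ellipsoid and not a default
    value. *)
Lemma John_s_ellipsoid_maximal s : 0 < s <= 1 ->
  let E := John_s_ellipsoid f s in
  0 < E.1.2 /\ maximal f s (E.1.2 `^ s) E.1.1 E.2.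
Proof.
move=> s01 E; have /andP[s0 s1] := s01.
have [|b [A [a M]]] := @maximal_exists R n f fp s; first by rewrite (ltW s0).
have /getPex J : exists E, is_John_s_ellipsoid f s E.1.1 E.1.2 E.2.
  by exists (A, b `^ s^-1, a); exact: maximal_John.
split; first by case: J.
exact: John_maximal.
Qed.

(** If the set [S] of good [s] were not a neighborhood, an ultrafilter finer than [0^'+] would
    contain its complement; yet along it the parameters tend to the unique flat maximizer, so it
    contains [S]. *)
Lemma John_parameters_cvg b (A : 'M[R]_n) a e : maximal f 0 b A a -> 0 < e ->
  \forall s \near 0^'+, let E := John_s_ellipsoid f s in
  [/\ `|E.1.2 `^ s - b| < e, forall i j, `|E.1.1 i j - A i j| < e &
      forall i, `|E.2 i 0 - a i 0| < e].
Proof.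
move=> M e0; set S := fun s : R => _; apply: contrapT => nS.
pose F0 := within (~` S) (0 : R)^'+.
have PF0 : ProperFilter F0.
  split; last exact: within_filter.
  move=> F00; apply: nS.
  have : \forall s \near (0 : R)^'+, (~` S) s -> False by exact: F00.
  by apply: filterS => s h; apply: contrapT => ns; exact: h ns.
have [G [UG FG]] := ultraFilterLemma PF0.
have PG : ProperFilter G by exact: ultra_proper.
have sub P : (\forall s \near 0^'+, P s) -> G P.
  by move=> h; apply: FG; apply: filterS h => s Ps _.
have GnS : G (~` S) by apply: FG; exact: withinT.
have s01 : G [set s : R | 0 < s <= 1].
  apply: sub; near=> s; apply/andP; split.
    by near: s; exact: nbhs_right_gt.
  by near: s; exact: nbhs_right_le.
have [fe0 M0] := M; have [b0 pA _] := fe0.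
have v0 : 0 < b * \det A by rewrite mulr_gt0// posdef_det_gt0.
have ge_v s : 0 < s <= 1 -> let E := John_s_ellipsoid f s in
    b * \det A <= E.1.2 `^ s * \det E.1.1.
  move=> h; have [_ [_ /(_ b A a) Ms]] := John_s_ellipsoid_maximal h.
  by apply: Ms; case/andP: h => s0 _; apply: feasible_mono => //; exact: ltW.
have id0 : s @[s --> G] --> (0 : R).
  have id0 : s @[s --> (0 : R)^'+] --> (0 : R).
    by apply: cvg_at_right_filter; exact: cvg_id.
  by move=> P /id0 h; exact: sub.
have [|b' [A' [a' [fe bb AA aa]]]] := @feasible_limit R n f fp R G id
    (fun s => (John_s_ellipsoid f s).1.2 `^ s)
    (fun s => (John_s_ellipsoid f s).1.1) (fun s => (John_s_ellipsoid f s).2)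
    0 _ UG v0 id0.
  apply: filterS s01 => s h; have [_ [fs _]] := John_s_ellipsoid_maximal h.
  by split => //; [case/andP: h => /ltW -> ->|exact: ge_v].
have v' : b * \det A <= b' * \det A'.
  by apply: (cvgr_to_ge (cvgM bb (cvg_det AA))); apply: filterS s01 => s /ge_v.
have M' : maximal f 0 b' A' a'.
  by split => // b1 A1 a1 /M0 /le_trans; apply.
have [bE AE aE] := maximal0_unique fp M M'.
have : G S.
  rewrite /S bE AE aE.
  have h1 : \forall s \near G, `|(John_s_ellipsoid f s).1.2 `^ s - b'| < e.
    by have /cvgr_distC_lt := bb; apply.
  have h2 : \forall s \near G, forall i j, `|(John_s_ellipsoid f s).1.1 i j - A' i j| < e.
    apply: filter_forall => i; apply: filter_forall => j.
    by have /cvgr_distC_lt := AA i j; apply.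
  have h3 : \forall s \near G, forall i, `|(John_s_ellipsoid f s).2 i 0 - a' i 0| < e.
    by apply: filter_forall => i; have /cvgr_distC_lt := aa i 0; apply.
  by apply: filterS (filterI (filterI h1 h2) h3) => s [[]].
move=> GS; have [s [? ?]] := filter_ex (filterI GS GnS); by [].
Unshelve. all: by end_near.
Qed.

End John.

(** * Uniform convergence *)

Section uniform.
Variables (R : realType) (n : nat).

Lemma cvg_enorm T (F : set_system T) {FF : Filter F} (x_ : T -> 'cV[R]_n) x :
  cvg_mx F x_ x -> enorm (x_ t) @[t --> F] --> enorm x.
Proof.
move=> xx.
have c : \sum_i x_ t i 0 ^+ 2 @[t --> F] --> \sum_i x i 0 ^+ 2.
  apply: (cvg_big (op := +%R)); first exact: add_continuous.
  move=> i _; rewrite expr2; under eq_fun do rewrite expr2.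
  by apply: cvgM; exact: xx.
exact: (cvg_comp _ _ c (@sqrt_continuous R _)).
Qed.

(** Points pushed radially away from the center leave the ellipsoid, so [x] is not interior. *)
Lemma sphere_boundary (A : 'M[R]_n) a x : posdef A ->
  enorm (invmx A *m (x - a)) = 1 -> boundary (ellipsoid A a) x.
Proof.
move=> pA x1; split; first by apply: subset_closure; apply/ellipsoidP; rewrite ?x1.
move=> xi.
pose x_ (t : R) := a + (1 + t) *: (x - a).
have cx : cvg_mx (0 : R)^'+ x_ x.
  have -> : x = a + (1 + 0) *: (x - a) by rewrite addr0 scale1r addrC subrK.
  apply: cvg_addmx; first exact: cvg_mx_cst.
  move=> i j; rewrite mxE; under eq_fun do rewrite mxE.
  apply: cvgM; last exact: cvg_cst.
  apply: cvgD; first exact: cvg_cst.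
  by apply: cvg_at_right_filter; exact: cvg_id.
have nx : \forall t \near (0 : R)^'+, ellipsoid A a (x_ t).
  have xn : x_ t @[t --> (0 : R)^'+] --> x by apply: cvg_mx_nbhs.
  exact: xn _ xi.
near (0 : R)^'+ => t.
have t0 : 0 < t by near: t; exact: nbhs_right_gt.
have xE : ellipsoid A a (x_ t) by near: t.
have {xE} xt := (ellipsoidP _ _ pA).1 xE.
move: xt; rewrite /x_ [a + _]addrC addrK -scalemxAr enormZ x1 mulr1 gtr0_norm; lra.
Unshelve. all: by end_near.
Qed.

(** Otherwise points outside [U] would have pulled-back norm arbitrarily close to 1, and would
    accumulate at a boundary point, which lies in the open set [U]. *)
Lemma boundary_gap (A : 'M[R]_n) a (U : set 'cV[R]_n) : posdef A -> open U ->
  boundary (ellipsoid A a) `<=` U ->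
  exists d, [/\ 0 < d, d <= 1 & forall x, ~ U x ->
    enorm (invmx A *m (x - a)) <= 1 - d \/ 1 + d <= enorm (invmx A *m (x - a))].
Proof.
move=> pA oU bU; apply: contrapT => nd.
have uA := posdef_unit pA.
pose nm x := enorm (invmx A *m (x - a)).
pose D : set R := [set d | 0 < d <= 1].
pose S d := [set x | ~ U x /\ 1 - d < nm x < 1 + d].
have FF : ProperFilter (filter_from D S).
  apply: filter_from_proper; last first.
    move=> d /andP[d0 d1]; apply: contrapT => nS; apply: nd; exists d; split => //.
    move=> x nUx; apply: contrapT => h; apply: nS; exists x; split => //.
    by apply/andP; split; rewrite ltNge; apply/negP => h'; apply: h; [left|right].
  apply: filter_from_filter; first by exists 1; rewrite /D /= ltr01 lexx.
  move=> d e /andP[d0 d1] /andP[e0 e1]; exists (Num.min d e).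
    by rewrite /D /= lt_min d0 e0 ge_min d1.
  have h1 : Num.min d e <= d by rewrite ge_min lexx.
  have h2 : Num.min d e <= e by rewrite ge_min lexx orbT.
  by move=> x [nUx /andP[? ?]]; split; split => //; apply/andP; split; lra.
have [G [UG FG]] := ultraFilterLemma FF.
have PG : ProperFilter G by exact: ultra_proper.
have GS d : 0 < d <= 1 -> G (S d) by move=> dD; apply: FG; exists d.
have G1 : G (S 1) by apply: GS; rewrite ltr01 lexx.
have [l cl] : exists l : 'cV[R]_n, cvg_mx G id l.
  pose C := (\sum_i \sum_j `|A i j|) * 2 + enorm a.
  have h (i : 'I_n) : exists l : R, (fun x : 'cV[R]_n => x i 0) @ G --> l.
    apply: (ultra_cvg (C := C)); apply: filterS G1 => x [_ /andP[_ x2]].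
    apply: le_trans (enorm_entry _ _) _.
    have -> : x = A *m (invmx A *m (x - a)) + a by rewrite mulKVmx// subrK.
    apply: le_trans (enormD _ _) _; rewrite lerD2r.
    apply: le_trans (enorm_mulmx _ _) _; apply: ler_wpM2l.
      by rewrite sumr_ge0// => k _; rewrite sumr_ge0.
    by rewrite -/(nm x); lra.
  have [l hl] := choice h.
  by exists (\col_i l i) => i j; rewrite mxE (ord1 j); exact: hl.
have cn : nm x @[x --> G] --> nm l.
  apply: cvg_enorm; apply: cvg_mulmx; first exact: cvg_mx_cst.
  by apply: cvg_addmx => //; exact: cvg_mx_cst.
have l1 : nm l = 1.
  apply/eqP; rewrite eq_le; apply/andP; split.
    apply/ler_addgt0Pl => e e0; have m01 : 0 < Num.min e 1 <= 1.
      by rewrite lt_min e0 ltr01 ge_min lexx orbT.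
    apply: (cvgr_to_le cn); apply: filterS (GS _ m01) => x [_ /andP[_ x2]].
    by have : Num.min e 1 <= e; [rewrite ge_min lexx|lra].
  apply/ler_addgt0Pl => e e0; have m01 : 0 < Num.min e 1 <= 1.
    by rewrite lt_min e0 ltr01 ge_min lexx orbT.
  rewrite -lerBlDl; apply: (cvgr_to_ge cn).
  apply: filterS (GS _ m01) => x [_ /andP[x2 _]].
  by have : Num.min e 1 <= e; [rewrite ge_min lexx|lra].
have Ul : U l by apply: bU; apply: sphere_boundary.
have xn : id x @[x --> G] --> l by apply: cvg_mx_nbhs.
have GU : G U by exact: (xn _ (open_nbhs_nbhs (conj oU Ul))).
have [x [Ux [nUx _]]] := filter_ex (filterI GU G1).
exact: nUx.
Qed.

Lemma uniform_cvg T (F : set_system T) {FF : Filter F} (U : set 'cV[R]_n)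
    (h : T -> 'cV[R]_n -> R) (g : 'cV[R]_n -> R) :
  (forall e, 0 < e -> \forall t \near F, forall x, U x -> `|g x - h t x| < e) ->
  {uniform U, h t @[t --> F] --> g}.
Proof.
move=> H P /uniform_nbhs[E [entE subP]].
have [e /= e0 eE] : exists2 e : R, 0 < e & [set xy | ball xy.1 e xy.2] `<=` E.
  by move: entE; rewrite -entourage_ballE => -[e e0 he]; exists e.
by apply: filterS (H e e0) => t ht; apply: subP => x Ux; apply: eE; exact: ht.
Qed.

(** With [y] the pullback by [B], the difference is [invmx A *m ((B - A) *m y + (c - a))], so only
    the inverse of the fixed matrix is estimated. As [x] ranges over the whole space, the bound has
    to grow with [enorm y]; [n * n + n] counts the parameters. *)
Lemma preimage_dist (A B : 'M[R]_n) (a c x : 'cV[R]_n) e : posdef A ->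
  posdef B -> 0 <= e ->
  (forall i j, `|B i j - A i j| <= e) -> (forall i, `|c i 0 - a i 0| <= e) ->
  enorm (invmx A *m (x - a) - invmx B *m (x - c)) <=
    (\sum_i \sum_j `|invmx A i j|) * (n * n + n)%:R * e *
    (enorm (invmx B *m (x - c)) + 1).
Proof.
move=> pA pB e0 BA ca; have uA := posdef_unit pA; have uB := posdef_unit pB.
set y := invmx B *m (x - c).
have xE : x = B *m y + c by rewrite /y mulKVmx// subrK.
have -> : invmx A *m (x - a) - y = invmx A *m ((B - A) *m y + (c - a)).
  have -> : (B - A) *m y + (c - a) = (x - a) - A *m y.
    by rewrite [in RHS]xE mulmxBl addrAC !addrA.
  by rewrite [in RHS]mulmxBr mulKmx.
apply: le_trans (enorm_mulmx _ _) _; rewrite -!mulrA ler_wpM2l//.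
  by rewrite sumr_ge0// => k _; rewrite sumr_ge0.
have nn0 : 0 <= (n%:R : R) by [].
have ey := enorm_ge0 y.
have h1 : enorm ((B - A) *m y) <= (n%:R * n%:R * e) * enorm y.
  apply: le_trans (enorm_mulmx _ _) _; apply: ler_wpM2r => //.
  apply: (@le_trans _ _ (\sum_(i < n) \sum_(j < n) e)).
    by apply: ler_sum => i _; apply: ler_sum => j _; rewrite !mxE BA.
  by rewrite !sumr_const !card_ord -mulrnA -[e *+ _]mulr_natl natrM.
have h2 : enorm (c - a) <= n%:R * e.
  apply: le_trans (enorm_le_sum _) _.
  apply: (@le_trans _ _ (\sum_(i < n) e)).
    by apply: ler_sum => i _; rewrite !mxE ca.
  by rewrite sumr_const card_ord -[e *+ _]mulr_natl.
apply: le_trans (enormD _ _) _; apply: le_trans (lerD h1 h2) _.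
rewrite natrD natrM.
have p1 : 0 <= n%:R * n%:R * e by rewrite !mulr_ge0.
have p2 : 0 <= n%:R * e * enorm y by rewrite !mulr_ge0.
rewrite -subr_ge0; have -> : (n%:R * n%:R + n%:R) * (e * (enorm y + 1)) -
  (n%:R * n%:R * e * enorm y + n%:R * e) = n%:R * n%:R * e + n%:R * e * enorm y.
  by ring.
exact: addr_ge0.
Qed.

End uniform.

Section John_function.
Variables (R : realType) (n : nat) (f : 'cV[R]_n -> R).
Hypothesis fp : proper_log_concave f.

Let f0 x : 0 <= f x. Proof. by case: fp => flc _ _; exact: log_concave_ge0. Qed.

(** Here [1 - |y|^2 >= d * (2 - d) >= d]; the bound is uniform in [y] and tends to 1 as [s] tends to
    0. *)
Lemma cap_ge_powR s d (y : 'cV[R]_n) : 0 <= s -> 0 < d <= 1 -> enorm y <= 1 - d ->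
  Num.sqrt d `^ s <= cap s y.
Proof.
move=> s0 /andP[d0 d1] yd; have ey := enorm_ge0 y.
have y1 : enorm y <= 1 by lra.
rewrite /cap y1; apply: ge0_ler_powR; rewrite ?nnegrE ?sqrtr_ge0//.
by apply: ler_wsqrtr; nra.
Qed.

Lemma John_function_cvg b (A : 'M[R]_n) a (U : set 'cV[R]_n) : maximal f 0 b A a ->
  open U -> boundary (ellipsoid A a) `<=` U ->
  {uniform ~` U, John_s_function f s @[s --> 0^'+] --> flat_fun b A a}.
Proof.
move=> M oU bU; apply: uniform_cvg => eps eps0.
have [fe _] := M; have [b0 pA _] := fe.
have [d [d0 d1 gap]] := boundary_gap pA oU bU.
pose K := (\sum_i \sum_j `|invmx A i j|) * (n * n + n)%:R.
have K0 : 0 <= K.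
  by rewrite mulr_ge0// sumr_ge0// => k _; rewrite sumr_ge0.
(* Small enough that [|u| <= 1 - d] gives [|y| <= 1 - d / 2], and [|u| >= 1 + d] gives [|y| > 1]:
   both pullbacks of [x] lie on the same side of the sphere. *)
pose eta := d / 4.
(* The three terms yield [K * e <= eta], a John height at most [b + 1], and half of the error
   [eps]. *)
pose e := Num.min (eta / (K + 1)) (Num.min 1 (eps / 2)).
have K1 : 0 < K + 1 by lra.
have e0 : 0 < e.
  by rewrite !lt_min ltr01 !divr_gt0.
have eK : K * e <= eta.
  have e1 : e <= eta / (K + 1) by rewrite ge_min lexx.
  have eta0 : 0 < eta by rewrite /eta; lra.
  have : (K + 1) * e <= eta by rewrite mulrC -ler_pdivlMr.
  lra.
have e_1 : e <= 1 by rewrite !ge_min lexx orbT.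
have e_eps : e <= eps / 2 by rewrite !ge_min lexx !orbT.
have sq0 : 0 < Num.sqrt (d / 2) by rewrite sqrtr_gt0; lra.
have sc : Num.sqrt (d / 2) `^ s @[s --> (0 : R)^'+] --> Num.sqrt (d / 2) `^ 0.
  by apply: cvg_powR => //; apply: cvg_at_right_filter; exact: cvg_id.
rewrite powRr0 in sc.
(* The other half of the error: a height at most [b + 1] times [1 - cap s y]. *)
have gt1 : 1 - eps / (2 * (b + 1)) < 1.
  by rewrite ltrBlDr ltrDl divr_gt0//; lra.
have near_c := cvgr_gt _ sc _ gt1.
have near_p := John_parameters_cvg fp M e0.
near=> s => x nUx.
have s0 : 0 < s by near: s; exact: nbhs_right_gt.
have s1 : s <= 1 by near: s; exact: nbhs_right_le.
have s01 : 0 < s <= 1 by rewrite s0 s1.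
have c1 : 1 - eps / (2 * (b + 1)) < Num.sqrt (d / 2) `^ s.
  by near: s; exact: near_c.
have nE : let E := John_s_ellipsoid f s in
  [/\ `|E.1.2 `^ s - b| < e, forall i j, `|E.1.1 i j - A i j| < e &
      forall i, `|E.2 i 0 - a i 0| < e].
  by near: s; exact: near_p.
have := John_s_ellipsoid_maximal fp s01; move: nE.
rewrite /John_s_function.
case: (John_s_ellipsoid f s) => [[B al] c] /= [bE BA ca] [al0 [feB _]].
have [_ pB _] := feB.
rewrite (height_powR c x s0 (ltW al0) pB) (flat_funE b a x pA).
have := preimage_dist x pA pB (ltW e0) (fun i j => ltW (BA i j))
  (fun i => ltW (ca i)).
have := gap x nUx.
move: (invmx A *m (x - a)) (invmx B *m (x - c)) => u y hu uy.
have ey := enorm_ge0 y; have eu := enorm_ge0 u.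
have {}uy : enorm (u - y) <= eta * (enorm y + 1).
  apply: (le_trans uy); rewrite -/K; apply: ler_wpM2r => //; lra.
have u_le : enorm u <= enorm y + enorm (u - y).
  by rewrite -{1}(subrK y u) addrC enormD.
have y_le : enorm y <= enorm u + enorm (u - y).
  have -> : enorm (u - y) = enorm (y - u) by exact: enorm_distC.
  by rewrite -{1}(subrK u y) addrC enormD.
case: hu => hu.
- have yd : enorm y <= 1 - d / 2 by rewrite /eta in uy; nra.
  have d2 : 0 < d / 2 <= 1 by apply/andP; split; lra.
  have cl := cap_ge_powR (ltW s0) d2 yd.
  have cu := cap_le1 y (ltW s0).
  have u1 : enorm u <= 1 by lra.
  rewrite cap0 u1 mulr1.
  move: bE; set be := al `^ s => hbe.
  have be0 : 0 < be by rewrite powR_gt0.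
  have be1 : be <= b + 1 by move: hbe; rewrite ltr_norml => /andP[_]; lra.
  set k := cap s y in cl cu *.
  have hk : be * (1 - k) < eps / 2.
    apply: (@le_lt_trans _ _ ((b + 1) * (1 - k))).
      by apply: ler_wpM2r => //; lra.
    have : 1 - k < eps / (2 * (b + 1)) by lra.
    rewrite ltr_pdivlMr; last lra.
    lra.
  have -> : b - be * k = - (be - b) + be * (1 - k) by ring.
  apply: le_lt_trans (ler_normD _ _) _; rewrite normrN.
  have : `|be * (1 - k)| = be * (1 - k).
    by apply: ger0_norm; apply: mulr_ge0; [exact: ltW|rewrite subr_ge0].
  lra.
- have u1 : (enorm u <= 1) = false by apply/negbTE; rewrite -ltNge; lra.
  have y1 : (enorm y <= 1) = false.
    apply/negbTE; rewrite -ltNge ltNge; apply/negP => y1.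
    by rewrite /eta in uy; nra.
  by rewrite /cap u1 y1 !mulr0 subrr normr0.
Unshelve. all: by end_near.
Qed.

End John_function.

Theorem theorem6p1 (R : realType) (d : nat) (f : 'cV[R]_d -> R)
    (hf : proper_log_concave f) :
  exists (A : 'M[R]_d) (alpha : R) (a : 'cV[R]_d),
    posdef A /\ 0 < alpha /\
    (forall x, flat_fun alpha A a x <= f x) /\
    (forall U : set 'cV[R]_d, open U -> boundary (ellipsoid A a) `<=` U ->
      {uniform ~` U, John_s_function f s @[s --> 0^'+] --> flat_fun alpha A a}) /\
    unique (max_flat_ellipsoid_function f) (flat_fun alpha A a).
Proof.
have f0 x : 0 <= f x by case: hf => flc _ _; exact: log_concave_ge0.
have h01 : 0 <= (0 : R) <= 1 by rewrite lexx ler01.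
have [b [A [a M]]] := maximal_exists hf h01.
have [fe Mx] := M; have [b0 pA _] := fe.
exists A, b, a; split => //; split => //.
have le_f := (feasible_flat f0 a b0 pA).1 fe.
split; first exact: le_f.
split; first by move=> U oU bU; exact: John_function_cvg.
split.
  split; [by exists b, A, a|exact: le_f|].
  move=> h [b' [A' [a' [b'0 pA' ->]]]] /(feasible_flat f0 a' b'0 pA') /Mx h'.
  rewrite (integral_flat a' (ltW b'0) pA') (integral_flat a (ltW b0) pA).
  by rewrite le_mul_kappa.
move=> g [[b' [A' [a' [b'0 pA' ->]]]] le_g Mg].
have fe' := (feasible_flat f0 a' b'0 pA').2 le_g.
(* Optimality among functions becomes optimality of parameters on cancelling the factor
   [kappa d 0]. *)
have M' : maximal f 0 b' A' a'.
  split => // b1 A1 a1 fe1; have [b10 pA1 _] := fe1.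
  have := Mg (flat_fun b1 A1 a1) _ _.
  rewrite (integral_flat a1 (ltW b10) pA1) (integral_flat a' (ltW b'0) pA').
  rewrite le_mul_kappa//; apply; first by exists b1, A1, a1.
  exact: (feasible_flat f0 a1 b10 pA1).1 fe1.
by have [-> -> ->] := maximal0_unique hf M M'.
Qed.
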